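(* Let $N\ge2$ and $\Gamma_1,\dots,\Gamma_N>0$. Let $\mathcal H_1\subset\mathbb R$ be the set of energies $H(\mathbf z)$ of normalised relative equilibria $\mathbf z$ of the planar $N$-vortex problem with vorticities $\Gamma_1,\dots,\Gamma_N$. Then $\mathcal H_1$ is a closed subset of $\mathbb R$, and its Lebesgue measure is $\mu(\mathcal H_1)=0$.
   Context: The planar $N$-vortex problem with vorticities $\Gamma_1,\dots,\Gamma_N$ is the system $\mathbf\Gamma\,\dot{\mathbf z}(t)=\mathcal J_N\nabla H(\mathbf z(t))$, for $\mathbf z=(z_1,\dots,z_N)$, $z_i=(x_i,y_i)\in\mathbb R^2$, on $\mathbb R^{2N}\setminus\Delta$, where $\Delta=\{\mathbf z: z_i=z_j\text{ for some }i<j\}$, $H(\mathbf z)=-\frac1{4\pi}\sum_{1\le i<j\le N}\Gamma_i\Gamma_j\log|z_i-z_j|^2$, $\mathbf\Gamma=\mathrm{diag}(\Gamma_1,\Gamma_1,\dots,\Gamma_N,\Gamma_N)$, and $\mathcal J_N$ is block diagonal with $N$ blocks $\mathbb J=\begin{bmatrix}0&1\\-1&0\end{bmatrix}$. $H$ is constant along each orbit (solution). An orbit is normalised if along it $\sum_i\Gamma_iz_i=0$ and $I(\mathbf z)=\sum_i\Gamma_i|z_i|^2=1$. A relative equilibrium is a solution of the form $z_i(t)=e^{\mathbb J\omega t}(z_i(0)-c)+c$ for all $i$, with $\omega\in\mathbb R$ and $c=\sum_i\Gamma_iz_i/\sum_i\Gamma_i$. *)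

(* Defs.v *)
From HB Require Import structures.
From mathcomp Require Import all_boot all_order all_algebra.
From mathcomp Require Import all_classical all_reals all_analysis.
From mathcomp Require Import ring.

Set Implicit Arguments.
Unset Strict Implicit.
Unset Printing Implicit Defensive.

Import Order.TTheory GRing.Theory Num.Theory.
Import numFieldNormedType.Exports.

Local Open Scope classical_set_scope.
Local Open Scope ring_scope.

(* The phase space R^{2N} is 'M[R]_(2, N): column i of a configuration z is
   the position z_i of vortex i. Under this identification Gamma, the diagonal
   2N x 2N matrix, acts by right multiplication with diag(Gamma_1,...,Gamma_N),
   and the block diagonal J_N acts by left multiplication with J. *)

(* J = [0 1; -1 0] *)
Definition J2 (R : realType) : 'M[R]_2 :=
  \matrix_(i, j) ((i < j)%N%:R - (j < i)%N%:R).

Definition expmx (R : realType) (A : 'M[R]_2) : 'M[R]_2 :=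
  limn (series (fun k : nat => (k`!%:R)^-1 *: A ^+ k)).

Lemma J2_sqr (R : realType) : J2 R * J2 R = -1.
Proof.
apply/matrixP => i j; rewrite !mxE !big_ord_recl big_ord0 !mxE.
by case: i => -[|[|//]] ? /=; case: j => -[|[|//]] ? /=; rewrite /= ?mulr1n ?mulr0n; ring.
Qed.

Lemma J2_exp (R : realType) k :
  J2 R ^+ k = if odd k then (-1) ^+ k./2 *: J2 R else (-1) ^+ k./2 *: 1.
Proof.
rewrite -[in LHS](odd_double_half k) exprD -muln2 mulnC exprM expr2 J2_sqr.
rewrite -scaleN1r exprZn expr1n.
case: (odd k); first by rewrite expr1 -scalerAr mulr1.
by rewrite expr0 mul1r.
Qed.

Lemma expmx_J2 (R : realType) (a : R) :
  expmx (a *: J2 R) = cos a *: 1 + sin a *: J2 R.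
Proof.
rewrite /expmx.
have -> : series (fun k : nat => (k`!%:R)^-1 *: (a *: J2 R) ^+ k) =
   (fun n => series (cos_coeff a) n *: (1 : 'M[R]_2) + series (sin_coeff a) n *: J2 R).
  apply/funext => n; rewrite /series /= !scaler_suml -big_split /=.
  apply: eq_bigr => k _; rewrite exprZn J2_exp /cos_coeff /sin_coeff /=.
  case: (boolP (odd k)) => ok /=; rewrite !(mul0r, mul1r, scale0r, add0r, addr0) !scalerA.
    congr (_ *: _); have -> : (k.-1)./2 = k./2.
      by case: k ok => //= k ok; rewrite uphalf_half; move: ok => /= /negbTE ->.
    ring.
  by congr (_ *: _); rewrite -exprnP; ring.
apply: cvg_lim => //; apply: cvgD; apply: cvgZr_tmp.
  by rewrite unlock; exact: is_cvg_series_cos_coeff.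
by rewrite unlock; exact: is_cvg_series_sin_coeff.
Qed.

(* The library norm on matrices is the sup norm, so the Euclidean one is
   spelled out. *)
Definition sqnorm (R : realType) (v : 'cV[R]_2) : R := \sum_k v k 0 ^+ 2.

Section Vortex.
Context {R : realType} {N : nat} (Gamma : 'I_N -> R).
Implicit Types (x : 'M[R]_(2, N)) (z : R -> 'M[R]_(2, N)).

Definition collision : set 'M[R]_(2, N) :=
  [set x | exists i j : 'I_N, (i < j)%N /\ col i x = col j x].

Definition energy x : R :=
  - (4 * pi)^-1 * \sum_(i < N) \sum_(j < N | (i < j)%N)
      Gamma i * Gamma j * ln (sqnorm (col i x - col j x)).

Definition gradient (f : 'M[R]_(2, N) -> R) x : 'M[R]_(2, N) :=
  \matrix_(a, i) 'D_(delta_mx a i) f x.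

Definition vorticity_mx : 'M[R]_N := diag_mx (\row_i Gamma i).

Definition solution z : Prop :=
  forall t : R, [/\ ~ collision (z t), derivable z t 1 &
    derive1 z t *m vorticity_mx = J2 R *m gradient energy (z t)].

Definition moment x : 'cV[R]_2 := \sum_i Gamma i *: col i x.

Definition vorticity_center x : 'cV[R]_2 := (\sum_i Gamma i)^-1 *: moment x.

Definition ang_impulse x : R := \sum_i Gamma i * sqnorm (col i x).

Definition normalised z : Prop :=
  forall t : R, moment (z t) = 0 /\ ang_impulse (z t) = 1.

Definition relative_equilibrium z : Prop :=
  solution z /\ exists omega : R, forall (i : 'I_N) (t : R),
    let c := vorticity_center (z 0) in
    col i (z t) =
      expmx ((omega * t) *: J2 R) *m (col i (z 0) - c) + c.

Definition normalised_re_energies : set R :=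
  [set h | exists z, [/\ relative_equilibrium z, normalised z &
                             forall t : R, energy (z t) = h]].

End Vortex.

(* Main.v *)
Require Import Defs.
From mathcomp Require Import all_boot all_order all_algebra.
From mathcomp Require Import all_classical all_reals all_analysis.
From mathcomp Require Import measurable_realfun ring lra zify.

Set Implicit Arguments.
Unset Strict Implicit.
Unset Printing Implicit Defensive.

Import Order.TTheory GRing.Theory Num.Theory.
Import numFieldNormedType.Exports.
Local Open Scope classical_set_scope.
Local Open Scope ring_scope.

(** Put F = H - (w0 / 2) (I - 1), where H is the energy, I the angular impulse
  and w0 = - (2 pi)^-1 sum_(i < j) Gamma_i Gamma_j.  Since H is invariant under
  translations and logarithmically homogeneous, Euler's identity
  [vortex_gradient_euler] forces the angular velocity of every normalised
  relative equilibrium to be w0.  Conversely, the same two properties make every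
  solution z of grad H = w0 z Gamma centred and of impulse 1, and rotating it
  with angular velocity w0 gives a relative equilibrium.  Hence the set of energies
  is the image under H of the set of critical points of F on the complement of
  the collisions, and H = F there ([normalised_re_energiesE], [criticalP]).

  It is closed because, at impulse 1, an upper bound on the energy bounds all
  mutual distances from below ([sqdist_separation]): the energies below a given
  level come from a compact set of critical points.

  It is null by Sard's theorem for real-valued functions on a space of dimension
  d, proved here without the implicit function theorem.  If all the derivatives
  of order 1 to d + 1 of a function p vanish on a set A, then p is Hoelder on A
  with an exponent larger than d, so p(A) is null ([negligible_flat]).  In
  general f(A) only sees f on A, so f may be changed off A.  Keep a smooth
  displacement c vanishing on A; the map x |-> x - c x then fixes A
  pointwise, and c is chosen so that its differential along A kills the
  coordinate directions already traded for a transversal coordinate.  Suppose the differential of p vanishes on A to some order.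
  Where the tangential derivatives of its partial derivatives also vanish, the
  next Taylor term of p is a homogeneous polynomial in the transversal
  directions, and Euler's formula shows how to cancel it by adding to p a
  function that vanishes on A ([vanish_flatten]).  Elsewhere one of the
  derivatives of p is a function that vanishes on the piece of A considered and
  has a nonzero tangential derivative: it is a new transversal coordinate, c can
  be corrected so as to lose one tangential direction ([retraction_step]), and
  one starts again from f.  There are at most d directions to lose. *)

(** * Functions smooth along finitely many directions *)

Section Lines.
Context {R : realType} {V : normedModType R}.
Implicit Types (f : V -> R) (x v : V) (t : R).

Lemma line_quotient f x v t :
  (fun h : R => h^-1 *: ((fun s => f (s *: v + x)) (h *: 1 + t) - f (t *: v + x)))
  = (fun h => h^-1 *: (f (h *: v + (t *: v + x)) - f (t *: v + x))).
Proof.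
by apply/funext => h /=; rewrite [_%:A]mulr1 scalerDl addrA.
Qed.

Lemma is_derive_line f x v t : derivable f (t *: v + x) v ->
  is_derive t 1 (fun s : R => f (s *: v + x)) ('D_v f (t *: v + x)).
Proof.
rewrite /derivable /derive -line_quotient => df.
by apply: DeriveDef.
Qed.

Lemma derivable_lineP f x v (d : R) :
  is_derive (0 : R) 1 (fun s : R => f (s *: v + x)) d -> is_derive x v f d.
Proof.
have E := line_quotient f x v 0.
rewrite scale0r add0r in E.
by move=> [+ <-]; rewrite /derivable /derive scale0r add0r E => df; apply: DeriveDef.
Qed.

Lemma derivable1_within (g dg : R -> R) (s t : R) :
  (forall r, s <= r <= t -> is_derive r 1 g (dg r)) ->
  {within `[s, t], continuous g}.
Proof.
move=> dgr; apply: derivable_within_continuous => r; rewrite in_itv/= => rst.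
by have := dgr r rst.
Qed.

Lemma MVT_line f x v s :
  (forall t, 0 <= t <= 1 -> derivable f ((t * s) *: v + x) v) ->
  exists2 c, 0 <= c <= 1 & f (s *: v + x) - f x = s * 'D_v f ((c * s) *: v + x).
Proof.
move=> df; pose g (r : R) := f ((r * s) *: v + x).
pose dg (r : R) := s * 'D_v f ((r * s) *: v + x).
have dgr (r : R) : 0 <= r <= 1 -> is_derive r 1 g (dg r).
  move=> r01; have dl := is_derive_line (df r r01).
  rewrite (_ : g = (fun t : R => f (t *: v + x)) \o (fun r : R => r * s)); last by [].
  have dm : is_derive r 1 (fun r : R => r * s) s.
    rewrite (_ : (fun _ => _) = s *: (@idfun R)); last first.
      by apply/funext => t; rewrite mulrC.
    by apply: is_derive_eq; rewrite [_%:A]mulr1.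
  by apply: is_derive_eq; rewrite mulrC.
have [c] := MVT_segment (@ler01 R) (fun r h => dgr r (subset_itv_oo_cc h)) (derivable1_within dgr).
rewrite in_itv/= => c01; rewrite /g mul1r mul0r scale0r add0r subr0 mulr1 => E.
by exists c.
Qed.

End Lines.

Section SmoothFunctions.
Context {R : realType} {V : normedModType R} {I : finType} (e : I -> V).
Implicit Types (U : set V) (f g : V -> R) (a b : I) (k : nat).

Definition partial a f : V -> R := fun x => 'D_(e a) f x.

(** Regularity is tested along the directions [e] only, so that everything
  reduces to calculus on lines. *)
Fixpoint Ck k U f : Prop :=
  {in U, forall x, {for x, continuous f}} /\
  if k is k'.+1 then
    forall a, {in U, forall x, derivable f x (e a)} /\ Ck k' U (partial a f)
  else True.

Definition smooth U f := forall k, Ck k U f.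

Lemma partialE a f x : partial a f x = 'D_(e a) f x. Proof. by []. Qed.

Lemma Ck_continuous k U f : Ck k U f -> {in U, forall x, {for x, continuous f}}.
Proof. by case: k => [|k] []. Qed.

Lemma CkW k U f : Ck k.+1 U f -> Ck k U f.
Proof.
elim: k f => [|k IH] f [cf df]; first by split.
by split=> // a; have [dfa Cfa] := df a; split=> //; exact: IH.
Qed.

Lemma smooth_continuous U f x : smooth U f -> U x -> {for x, continuous f}.
Proof. by move=> sf Ux; apply: (Ck_continuous (sf 0%N)); rewrite inE. Qed.

Lemma smooth_derivable U f a x : smooth U f -> U x -> derivable f x (e a).
Proof. by move=> sf Ux; have [_ /(_ a)[h _]] := sf 1%N; apply: h; rewrite inE. Qed.

Lemma smooth_partial U f a : smooth U f -> smooth U (partial a f).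
Proof. by move=> sf k; have [_ /(_ a)[]] := sf k.+1. Qed.

Lemma open_near U (P : V -> Prop) x : open U -> U x -> (forall y, U y -> P y) ->
  \forall y \near x, P y.
Proof. by move=> oU Ux UP; apply: filterS (open_nbhs_nbhs (conj oU Ux)). Qed.

Lemma partial_eq U f g a : open U -> {in U, f =1 g} -> {in U, partial a f =1 partial a g}.
Proof.
move=> oU fg x; rewrite inE => Ux; apply: near_eq_derive.
by apply: (open_near oU Ux) => y Uy; apply: fg; rewrite inE.
Qed.

Lemma Ck_eq k U f g : open U -> {in U, f =1 g} -> Ck k U f -> Ck k U g.
Proof.
move=> oU; elim: k f g => [|k IH] f g fg [cf df].
all: have cg : {in U, forall x, {for x, continuous g}}
  by (move=> x Ux; have {}cf := cf x Ux;
      rewrite /prop_for /continuous_at -fg//; apply: cvg_trans cf;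
      apply: near_eq_cvg; move: Ux; rewrite inE => Ux;
      by apply: (open_near oU Ux) => y Uy; apply: fg; rewrite inE).
  by split.
split=> // a; have [dfa Cfa] := df a; split; last first.
  by apply: IH Cfa; exact: partial_eq.
move=> x Ux; apply: near_eq_derivable (dfa x Ux).
by move: Ux; rewrite inE => Ux; apply: (open_near oU Ux) => y Uy; apply: fg; rewrite inE.
Qed.

Lemma CkS k U U' f : U' `<=` U -> Ck k U f -> Ck k U' f.
Proof.
move=> U'U; have iU x : x \in U' -> x \in U by rewrite !inE; exact: U'U.
elim: k f => [|k IH] f [cf df]; split=> //; try by move=> x /iU /cf.
by move=> a; have [dfa /IH Cfa] := df a; split=> // x /iU /dfa.
Qed.

Lemma Ck_cst k U (c : R) : Ck k U (cst c).
Proof.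
elim: k c => [|k IH] c; split=> //; try by move=> x _; exact: cst_continuous.
move=> a; split; first by move=> x _; exact: derivable_cst.
rewrite (_ : partial a (cst c) = cst 0); first exact: IH.
by apply/funext => x; rewrite partialE derive_cst.
Qed.

Lemma CkD k U f g : open U -> Ck k U f -> Ck k U g -> Ck k U (f + g).
Proof.
move=> oU; elim: k f g => [|k IH] f g [cf df] [cg dg].
all: split=> //; try by move=> x Ux; apply: continuousD; [exact: cf|exact: cg].
move=> a; have [dfa Cfa] := df a; have [dga Cga] := dg a; split.
  by move=> x Ux; apply: derivableD; [exact: dfa|exact: dga].
apply: Ck_eq (IH _ _ Cfa Cga) => // x Ux.
by rewrite partialE deriveD//; [exact: dfa|exact: dga].
Qed.

Lemma CkM k U f g : open U -> Ck k U f -> Ck k U g -> Ck k U (f * g).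
Proof.
move=> oU; elim: k f g => [|k IH] f g Hf Hg.
all: have cf := Ck_continuous Hf; have cg := Ck_continuous Hg.
all: split=> //; try by move=> x Ux; apply: continuousM; [exact: cf|exact: cg].
move=> a; have [_ /(_ a)[dfa Cfa]] := Hf; have [_ /(_ a)[dga Cga]] := Hg; split.
  by move=> x Ux; apply: derivableM; [exact: dfa|exact: dga].
apply: (@Ck_eq _ _ (f * partial a g + g * partial a f)) => //.
  by move=> x Ux; rewrite partialE deriveM//; [exact: dfa|exact: dga].
by apply: CkD => //; apply: IH => //; exact: CkW.
Qed.

Lemma smoothS U U' f : U' `<=` U -> smooth U f -> smooth U' f.
Proof. by move=> U'U sf k; exact: CkS (sf k). Qed.

Lemma smooth_cst U (c : R) : smooth U (cst c).
Proof. by move=> k; exact: Ck_cst. Qed.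

Lemma smoothD U f g : open U -> smooth U f -> smooth U g -> smooth U (f + g).
Proof. by move=> oU sf sg k; exact: CkD. Qed.

Lemma smoothM U f g : open U -> smooth U f -> smooth U g -> smooth U (f * g).
Proof. by move=> oU sf sg k; exact: CkM. Qed.

Lemma smoothN U f : open U -> smooth U f -> smooth U (- f).
Proof.
move=> oU sf; rewrite (_ : - f = cst (-1) * f); last first.
  by apply/funext => x; rewrite !fctE mulN1r.
by apply: smoothM => //; exact: smooth_cst.
Qed.

Lemma smooth_sum U (J : Type) (r : seq J) (P : pred J) (F : J -> V -> R) :
  open U -> (forall j, P j -> smooth U (F j)) ->
  smooth U (\sum_(j <- r | P j) F j).
Proof.
move=> oU sF; elim/big_ind : _ => //; first exact: smooth_cst.
by move=> f g; exact: smoothD.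
Qed.

(** The derivatives of an inverse or of a logarithm are expressed through the
  function itself, so its regularity is gained one order at a time. *)
Lemma smooth_bootstrap U f :
  {in U, forall x, {for x, continuous f}} ->
  (forall a, {in U, forall x, derivable f x (e a)}) ->
  (forall k, Ck k U f -> forall a, Ck k U (partial a f)) -> smooth U f.
Proof.
move=> cf df H; elim=> [|k IH]; split=> // a; split; first exact: df.
exact: H.
Qed.

Lemma smoothV U f : open U -> smooth U f -> (forall x, U x -> f x != 0) ->
  smooth U (fun x => (f x)^-1).
Proof.
move=> oU sf f0; apply: smooth_bootstrap.
- move=> x; rewrite inE => Ux; apply: cvgV; first exact: f0.
  exact: smooth_continuous Ux.
- move=> a x; rewrite inE => Ux; apply: derivableV; first exact: f0.
  exact: smooth_derivable Ux.
move=> k Cf a.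
apply: (@Ck_eq _ _ (cst (-1) * ((fun x => (f x)^-1) * ((fun x => (f x)^-1) * partial a f)))) => //.
  move=> x; rewrite inE => Ux; rewrite partialE deriveV; [|exact: f0|exact: smooth_derivable Ux].
  rewrite !fctE mulN1r /= partialE expr2 invfM -mulNr; rewrite /GRing.scale/=; ring.
by do ![apply: CkM => //]; [exact: Ck_cst|exact: smooth_partial].
Qed.

Lemma smooth_ln U f : open U -> smooth U f -> (forall x, U x -> 0 < f x) ->
  smooth U (fun x => ln (f x)) /\
  forall a x, U x -> partial a (fun x => ln (f x)) x = partial a f x / f x.
Proof.
move=> oU sf f0.
have D a x : U x -> is_derive x (e a) (fun x => ln (f x)) (partial a f x / f x).
  move=> Ux; apply: derivable_lineP.
  have df : is_derive (0 : R) 1 (fun s : R => f (s *: e a + x)) (partial a f x).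
    have := @is_derive_line _ _ f x (e a) 0; rewrite scale0r add0r; apply.
    exact: smooth_derivable Ux.
  apply: is_derive_eq.
    apply: (@is_derive1_comp _ (@ln R) (fun s : R => f (s *: e a + x))) => //.
    by apply: is_derive1_ln; rewrite scale0r add0r; exact: f0.
  by rewrite /= scale0r add0r mulrC.
split; last by move=> a x Ux; have := D a x Ux => Dx; exact: derive_val.
apply: smooth_bootstrap.
- move=> x; rewrite inE => Ux.
  by apply: continuous_comp (continuous_ln (f0 _ Ux)); exact: smooth_continuous Ux.
- by move=> a x; rewrite inE => /(D a)[].
move=> k _ a; apply: (@Ck_eq _ _ (partial a f * (fun x => (f x)^-1))) => //.
  by move=> x; rewrite inE => Ux; have Dx := D a x Ux; rewrite [RHS]derive_val.
apply: CkM => //; first exact: smooth_partial.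
by apply: smoothV => // x /f0; exact: lt0r_neq0.
Qed.

(** The mean value theorem along [e a], then along [e b]. *)
Lemma second_difference U f a b x s : smooth U f -> 0 < s ->
  (forall c d, 0 <= c <= s -> 0 <= d <= s -> U (d *: e b + (c *: e a + x))) ->
  exists c d, [/\ 0 <= c <= s, 0 <= d <= s &
    f (s *: e a + (s *: e b + x)) - f (s *: e a + x) - (f (s *: e b + x) - f x)
    = s ^+ 2 * partial b (partial a f) (d *: e b + (c *: e a + x))].
Proof.
move=> sf s0 HU; have s0' := ltW s0.
pose phi (t : R) := f (t *: e a + (s *: e b + x)) - f (t *: e a + x).
pose dphi (t : R) := partial a f (t *: e a + (s *: e b + x)) - partial a f (t *: e a + x).
have dphiE (t : R) : 0 <= t <= s -> is_derive t 1 phi (dphi t).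
  move=> ts.
  have H1 : is_derive t 1 (fun t : R => f (t *: e a + (s *: e b + x)))
      (partial a f (t *: e a + (s *: e b + x))).
    apply: is_derive_line; apply: smooth_derivable sf _; rewrite addrCA.
    by apply: HU => //; rewrite s0' lexx.
  have H2 : is_derive t 1 (fun t : R => f (t *: e a + x)) (partial a f (t *: e a + x)).
    apply: is_derive_line; apply: smooth_derivable sf _.
    by rewrite -[_ + _]add0r -[0 in X in U X](scale0r (e b)); apply: HU; rewrite ?lexx.
  exact: is_deriveB.
have [c] := MVT_segment s0' (fun r h => dphiE r (subset_itv_oo_cc h)) (derivable1_within dphiE).
rewrite in_itv/= => c0s E1.
have [] := @MVT_line _ _ (partial a f) (c *: e a + x) (e b) s.
  move=> t /andP[t0 t1]; apply: smooth_derivable (smooth_partial a sf) _.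
  by apply: HU => //; rewrite mulr_ge0//= ger_pMl.
move=> d /andP[d0 d1] E2; exists c, (d * s); split=> //.
  by rewrite mulr_ge0//= ger_pMl.
move: E1; rewrite /phi /dphi scale0r !add0r subr0 => ->.
by rewrite addrCA E2 expr2 mulrAC.
Qed.

(** Both mixed derivatives are limits of the same second difference. *)
Lemma partialC U f a b : open U -> smooth U f ->
  {in U, partial a (partial b f) =1 partial b (partial a f)}.
Proof.
move=> oU sf x; rewrite inE => Ux; apply/eqP; rewrite -subr_eq0 -normr_eq0.
apply/eqP/le_anti; rewrite normr_ge0 andbT; apply/ler_addgt0Pl => eps eps0; rewrite addr0.
have cab : {for x, continuous (partial a (partial b f))}.
  by apply: smooth_continuous Ux; do 2!apply: smooth_partial.
have cba : {for x, continuous (partial b (partial a f))}.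
  by apply: smooth_continuous Ux; do 2!apply: smooth_partial.
have eps2 : 0 < eps / 2 by rewrite divr_gt0.
have near_all : \forall y \near x, [/\ U y,
    `|partial a (partial b f) x - partial a (partial b f) y| < eps / 2 &
    `|partial b (partial a f) x - partial b (partial a f) y| < eps / 2].
  apply: filterS3 (fun y => @And3 _ _ _) _ _ _.
  - exact: (open_near oU Ux).
  - by move/cvgrPdist_lt : cab; apply.
  - by move/cvgrPdist_lt : cba; apply.
have [d /= d0 Hd] := (nbhs_ballP _ _).1 near_all.
pose M := `|e a| + `|e b| + 1.
have M0 : 0 < M by rewrite ltr_wpDl// addr_ge0.
pose s := d / 2 / M.
have s0 : 0 < s by rewrite !divr_gt0.
have close c1 c2 : 0 <= c1 <= s -> 0 <= c2 <= s ->
    ball x d (c1 *: e a + (c2 *: e b + x)).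
  move=> /andP[c10 c1s] /andP[c20 c2s]; rewrite -ball_normE /= opprD addrCA.
  rewrite opprD [x + _]addrC -!addrA addNr addr0 -opprD normrN.
  apply: le_lt_trans (ler_normD _ _) _; rewrite !normrZ !ger0_norm//.
  apply: (@le_lt_trans _ _ (s * M)).
    rewrite /M !mulrDr mulr1 -[leLHS]addr0 !lerD ?ler_wpM2r// ltW//.
  by rewrite /s divfK ?gt_eqF// gtr_pMr// invf_lt1 ?ltr1n.
have closeC c1 c2 : 0 <= c1 <= s -> 0 <= c2 <= s ->
    ball x d (c2 *: e b + (c1 *: e a + x)).
  by move=> ? ?; rewrite addrCA; exact: close.
have [c1 [d1 [c1s d1s E1]]] := @second_difference U f a b x s sf s0
  (fun c d hc hd => let: And3 h _ _ := Hd _ (closeC c d hc hd) in h).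
have [c2 [d2 [c2s d2s E2]]] := @second_difference U f b a x s sf s0
  (fun c d hc hd => let: And3 h _ _ := Hd _ (close d c hd hc) in h).
have E : partial b (partial a f) (d1 *: e b + (c1 *: e a + x)) =
         partial a (partial b f) (d2 *: e a + (c2 *: e b + x)).
  apply: (mulfI (_ : s ^+ 2 != 0)); first by rewrite expf_neq0// gt_eqF.
  have R4 (p q r t : R) : p - q - (r - t) = p - r - (q - t) by ring.
  rewrite -E1 -E2; rewrite [s *: e b + (s *: e a + x)]addrCA.
  by move: (f _) (f _) (f _) (f _) => p q r t; exact: R4.
have [_ _ H1] := Hd _ (closeC _ _ c1s d1s).
have [_ H2 _] := Hd _ (close _ _ d2s c2s).
rewrite E in H1; move: H1 H2.
move: (partial a (partial b f) x) (partial b (partial a f) x) (partial a (partial b f) _) => p q r H1 H2.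
have := ler_distD r p q; rewrite [`|r - q|]distrC => /le_trans; apply.
by rewrite [leRHS]splitr; apply: lerD; exact: ltW.
Qed.

End SmoothFunctions.

(** * Vanishing to finite order, and flattening along a set *)

Section Pointwise.
Context {R : realType} {T : pointedType}.
Implicit Types (f g : T -> R) (x : T).

Let add_at f g x : (f + g) x = f x + g x. Proof. by []. Qed.
Let mul_at f g x : (f * g) x = f x * g x. Proof. by []. Qed.
Let opp_at f x : (- f) x = - f x. Proof. by []. Qed.
Let scale_at (k : R) f x : (k *: f) x = k * f x. Proof. by []. Qed.

Definition pointwiseE := (add_at, mul_at, opp_at, scale_at).

End Pointwise.

Section Leibniz.
Context {R : realType} {V : normedModType R} {I : finType} (e : I -> V).
Context (U : set V) (oU : open U).
Implicit Types (f g h p : V -> R) (a b d : I) (m : nat).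
Local Notation partial := (partial e).
Local Notation smooth := (smooth e U).

Lemma partialD f g a : smooth f -> smooth g ->
  {in U, partial a (f + g) =1 partial a f + partial a g}.
Proof.
move=> sf sg x; rewrite inE => Ux; rewrite partialE deriveD//.
all: exact: smooth_derivable Ux.
Qed.

Lemma partialM f g a : smooth f -> smooth g ->
  {in U, partial a (f * g) =1 partial a f * g + f * partial a g}.
Proof.
move=> sf sg x; rewrite inE => Ux; rewrite partialE deriveM//.
- by rewrite !pointwiseE addrC [g x *: _]mulrC.
- exact: smooth_derivable Ux.
- exact: smooth_derivable Ux.
Qed.

Lemma smoothZ (k : R) f : smooth f -> smooth (k *: f).
Proof.
move=> sf; rewrite (_ : k *: f = cst k * f); last by apply/funext.
by apply: smoothM => //; exact: smooth_cst.
Qed.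

Lemma smoothB f g : smooth f -> smooth g -> smooth (f - g).
Proof. by move=> sf sg; apply: smoothD => //; exact: smoothN. Qed.

Lemma partialZ (k : R) f a : smooth f -> {in U, partial a (k *: f) =1 k *: partial a f}.
Proof.
move=> sf x; rewrite inE => Ux; rewrite partialE deriveZ//.
exact: smooth_derivable Ux.
Qed.

Lemma partialB f g a : smooth f -> smooth g ->
  {in U, partial a (f - g) =1 partial a f - partial a g}.
Proof.
move=> sf sg x; rewrite inE => Ux; rewrite partialE deriveB//.
all: exact: smooth_derivable Ux.
Qed.

Lemma partial_sum (J : Type) (r : seq J) (P : pred J) (F : J -> V -> R) a :
  (forall j, P j -> smooth (F j)) ->
  {in U, partial a (\sum_(j <- r | P j) F j) =1 \sum_(j <- r | P j) partial a (F j)}.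
Proof.
move=> sF; elim: r => [|j r IH] x Ux.
  by rewrite !big_nil partialE; exact: derive_cst.
rewrite !big_cons; case: ifP => Pj; last exact: IH.
rewrite (partialD a (sF j Pj) _ Ux); last exact: smooth_sum.
by rewrite [LHS]pointwiseE [RHS]pointwiseE IH.
Qed.

Lemma partial_cst (k : R) a x : partial a (cst k) x = 0.
Proof. exact: derive_cst. Qed.

End Leibniz.


Section VanishingOrder.
Context {R : realType} {V : normedModType R} {I : finType} (e : I -> V).
Context (U A : set V) (oU : open U) (AU : A `<=` U).
Implicit Types (f g h p : V -> R) (c : I -> V -> R) (a b d : I) (m : nat).
Local Notation partial := (partial e).
Local Notation smooth := (smooth e U).

Fixpoint vanish (B : set V) m h : Prop :=
  {in B, forall x, h x = 0} /\
  if m is m'.+1 then forall a, vanish B m' (partial a h) else True.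

Lemma vanish0 m h : vanish A m h -> {in A, forall x, h x = 0}.
Proof. by case: m => [|m] []. Qed.

Lemma vanishW m h : vanish A m.+1 h -> vanish A m h.
Proof.
elim: m h => [|m IH] h [h0 dh]; first by split.
by split=> // a; apply: IH; exact: dh.
Qed.

Let iU x : x \in A -> x \in U. Proof. by rewrite !inE; exact: AU. Qed.

Lemma vanish_eq m f g : {in U, f =1 g} -> vanish A m f -> vanish A m g.
Proof.
elim: m f g => [|m IH] f g fg [f0 df]; split=> //.
- by move=> x Ax; rewrite -fg ?f0//; exact: iU.
- by move=> x Ax; rewrite -fg ?f0//; exact: iU.
by move=> a; apply: IH (df a); exact: partial_eq.
Qed.

Lemma vanishD m f g : smooth f -> smooth g ->
  vanish A m f -> vanish A m g -> vanish A m (f + g).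
Proof.
elim: m f g => [|m IH] f g sf sg [f0 df] [g0 dg].
all: split=> //; try by move=> x Ax; rewrite pointwiseE f0// g0// addr0.
move=> a; apply: (@vanish_eq _ (partial a f + partial a g)).
  by move=> x Ux; rewrite (partialD (U:=U)).
by apply: IH; [exact: smooth_partial|exact: smooth_partial|exact: df|exact: dg].
Qed.

Lemma vanishM m f g : smooth f -> smooth g -> vanish A m g -> vanish A m (f * g).
Proof.
elim: m f g => [|m IH] f g sf sg Hg; have g0 := vanish0 Hg.
all: split=> //; try by move=> x Ax; rewrite pointwiseE g0// mulr0.
move=> a; have [_ /(_ a) dg] := Hg.
apply: (@vanish_eq _ (partial a f * g + f * partial a g)).
  by move=> x Ux; rewrite (partialM (U:=U)).
have sdf : smooth (partial a f) by exact: smooth_partial.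
have sdg : smooth (partial a g) by exact: smooth_partial.
apply: vanishD; [exact: smoothM|exact: smoothM| |]; apply: IH => //.
exact: vanishW.
Qed.

Lemma vanishZ m (k : R) f : smooth f -> vanish A m f -> vanish A m (k *: f).
Proof.
move=> sf vf; rewrite (_ : k *: f = cst k * f); last by apply/funext.
by apply: vanishM => //; exact: smooth_cst.
Qed.

Lemma vanishB m f g : smooth f -> smooth g ->
  vanish A m f -> vanish A m g -> vanish A m (f - g).
Proof.
move=> sf sg vf vg; rewrite -[- g]scaleN1r; apply: vanishD => //.
  exact: smoothZ.
exact: vanishZ.
Qed.

Lemma vanish_cst0 m : vanish A m (cst 0).
Proof.
elim: m => [|m IH]; split=> // a.
by apply: vanish_eq IH => x _; rewrite partial_cst.
Qed.

Lemma vanish_sum m (F : I -> V -> R) : (forall j, smooth (F j)) ->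
  (forall j, vanish A m (F j)) -> vanish A m (\sum_j F j).
Proof.
move=> sF vF.
suff [] : smooth (\sum_j F j) /\ vanish A m (\sum_j F j) by [].
elim/big_ind : _ => [|f g [sf vf] [sg vg]|//].
  by split; [exact: smooth_cst|exact: vanish_cst0].
by split; [exact: smoothD|exact: vanishD].
Qed.

(** The family [c] is the displacement of the map [x |-> x - c x]; it is also
  used as a vector field. *)
Definition field_along c p : V -> R := \sum_b c b * partial b p.

(** The derivative of [p] along the image of [e a] under the differential of
  [x |-> x - c x]. *)
Definition tangential c a p : V -> R := partial a p - \sum_b partial a (c b) * partial b p.

Section Retraction.
Context (c : I -> V -> R) (sc : forall b, smooth (c b)).
Context (vc : forall b, vanish A 0 (c b)).
Local Notation E := (field_along c).
Local Notation Z := (tangential c).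

Lemma smooth_field_along p : smooth p -> smooth (E p).
Proof.
by move=> sp; apply: smooth_sum => // b _; apply: smoothM => //; exact: smooth_partial.
Qed.

Lemma smooth_tangential a p : smooth p -> smooth (Z a p).
Proof.
move=> sp; apply: smoothB => //; first exact: smooth_partial.
by apply: smooth_sum => // b _; apply: smoothM => //; exact: smooth_partial.
Qed.

Lemma partial_field_along a p : smooth p ->
  {in U, partial a (E p) =1 E (partial a p) + partial a p - Z a p}.
Proof.
move=> sp x Ux; have sdp b : smooth (partial b p) by exact: smooth_partial.
rewrite (partial_sum oU)//; last by move=> b _; exact: smoothM.
rewrite [RHS](_ : _ = E (partial a p) x + (\sum_b partial a (c b) * partial b p) x).
  rewrite /field_along !fct_sumE -big_split/=; apply: eq_bigr => b _.
  rewrite (partialM a (sc b) (sdp b) Ux).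
  rewrite -[LHS]/(partial a (c b) x * partial b p x + c b x * partial a (partial b p) x).
  by rewrite (partialC a b oU sp Ux) addrC.
by rewrite /tangential !pointwiseE; ring.
Qed.

Lemma tangential_partial a b p : smooth p ->
  {in U, Z b (partial a p) =1 partial a (Z b p) + \sum_d partial a (partial b (c d)) * partial d p}.
Proof.
move=> sp x Ux; have sdp d : smooth (partial d p) by exact: smooth_partial.
have sdc d : smooth (partial b (c d)) by exact: smooth_partial.
have sM d : smooth (partial b (c d) * partial d p) by exact: smoothM.
rewrite [RHS]pointwiseE (partialB (U:=U))//; last by apply: smooth_sum.
rewrite [X in _ = X + _]pointwiseE [X in _ = _ - X + _](partial_sum oU)//.
rewrite /tangential [LHS]pointwiseE (partialC _ _ oU)// -addrA; congr (_ + _).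
rewrite !pointwiseE !fct_sumE -!sumrN -big_split/=.
apply: eq_bigr => d _.
rewrite (partialM a (sdc d) (sdp d) Ux) !pointwiseE (partialC d a oU sp Ux).
by move: (partial a (partial b (c d)) x * _) (partial b (c d) x * _) => r t; ring.
Qed.

(** Tangential and partial derivatives commute up to first order operators,
  because partial derivatives commute with each other. *)
Lemma vanish_tangential_partial m a b p : smooth p -> (forall d, vanish A m (partial d p)) ->
  vanish A m (partial a (Z b p)) -> vanish A m (Z b (partial a p)).
Proof.
move=> sp vp vZ; have sdp d : smooth (partial d p) by exact: smooth_partial.
have sdc d : smooth (partial a (partial b (c d))) by do 2!apply: smooth_partial.
apply: vanish_eq; first by move=> x Ux; apply/esym; exact: tangential_partial.
have sM d : smooth (partial a (partial b (c d)) * partial d p) by exact: smoothM.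
apply: vanishD => //; first by apply: smooth_partial; exact: smooth_tangential.
  exact: smooth_sum.
by apply: vanish_sum => // d; exact: vanishM.
Qed.

Lemma field_along0 p : {in A, forall x, E p x = 0}.
Proof.
move=> x Ax; rewrite /field_along fct_sumE big1// => b _.
by rewrite pointwiseE (vanish0 (vc b))// mul0r.
Qed.

(** To leading order, [p] is a homogeneous polynomial of degree [m.+1] in
  coordinates transversal to [A], because its tangential derivatives vanish as
  much as [p] itself; [c] is to first order the Euler field of these
  coordinates. *)
Lemma vanish_euler m p : smooth p -> vanish A m p -> (forall a, vanish A m (Z a p)) ->
  vanish A m.+1 (E p - m.+1%:R *: p).
Proof.
elim: m p => [|m IH] p sp vp vZ.
all: have sE a : smooth (E (partial a p)) by
  apply: smooth_field_along; exact: smooth_partial.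
all: have sdp a : smooth (partial a p) by exact: smooth_partial.
all: have sZ a : smooth (Z a p) by exact: smooth_tangential.
all: split; first by (move=> x Ax; rewrite !pointwiseE field_along0// (vanish0 vp)// mulr0 subr0).
all: move=> a; have Ea := partial_field_along a sp.
  apply: (@vanish_eq _ (E (partial a p) - Z a p)).
    move=> x Ux; rewrite (partialB (U:=U))//; [|exact: smooth_field_along|exact: smoothZ].
    rewrite [RHS]pointwiseE Ea// [partial a (1 *: p)](_ : _ = partial a p) ?scale1r//.
    by rewrite !pointwiseE; ring.
  apply: vanishB => //.
  by split=> // x Ax; exact: field_along0.
apply: (@vanish_eq _ (E (partial a p) - m.+1%:R *: partial a p - Z a p)).
  move=> x Ux; rewrite (partialB (U:=U))//; [|exact: smooth_field_along|exact: smoothZ].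
  rewrite [RHS]pointwiseE Ea// [in RHS]pointwiseE [X in _ = _ - X](partialZ (U:=U))// !pointwiseE.
  rewrite -[m.+2]add1n natrD; ring.
have [_ /(_ _)vdp] := vp.
apply: vanishB => //; first by apply: smoothB => //; exact: smoothZ.
apply: IH => [||b]; [exact: sdp|exact: vdp|].
apply: vanish_tangential_partial; [exact: sp|exact: vdp|].
by have [_ /(_ a)] := vZ b.
Qed.

(** The leading term of [p] transversally to [A] has degree [m.+2], so it agrees
  with [m.+2%:R^-1 *: E p] up to terms of higher order, and [E p] vanishes on [A]. *)
Lemma vanish_flatten m p : smooth p -> (forall a, vanish A m (partial a p)) ->
  (forall a, vanish A m.+1 (Z a p)) ->
  exists q, [/\ smooth q, {in A, q =1 p} & forall a, vanish A m.+1 (partial a q)].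
Proof.
move=> sp vp vZ; exists (p - m.+2%:R^-1 *: E p).
have sE := smooth_field_along sp.
have sdp a : smooth (partial a p) by exact: smooth_partial.
split.
- by apply: smoothB => //; exact: smoothZ.
- by move=> x Ax; rewrite !pointwiseE field_along0// mulr0 subr0.
move=> a; apply: (@vanish_eq _ (m.+2%:R^-1 *:
    (Z a p - (E (partial a p) - m.+1%:R *: partial a p)))).
  move=> x Ux; rewrite (partialB (U:=U))//; last exact: smoothZ.
  rewrite !pointwiseE (partialZ (U:=U))// !pointwiseE partial_field_along// !pointwiseE.
  rewrite [LHS](_ : _ = m.+2%:R^-1 * ((1 + m.+1%:R) * partial a p x - (E (partial a p) x + partial a p x - Z a p x))).
    by rewrite -natr1 [_ + 1]addrC mulrBr mulKf// addrC -natrD.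
  ring.
have sEd : smooth (E (partial a p)) by exact: smooth_field_along.
have sZ : smooth (Z a p) by exact: smooth_tangential.
have sZd : smooth (m.+1%:R *: partial a p) by exact: smoothZ.
have sB : smooth (E (partial a p) - m.+1%:R *: partial a p) by exact: smoothB.
apply: vanishZ; first exact: smoothB.
apply: vanishB => //; apply: vanish_euler => // b.
by apply: vanish_tangential_partial => //; have [_ /(_ a)] := vZ b.
Qed.

Fixpoint partials (w : seq I) p : V -> R := if w is d :: w' then partials w' (partial d p) else p.

(** Only the derivatives of highest order need to be tested: the lower ones are
  combinations of derivatives of [p] which vanish on [A] anyway. *)
Lemma vanish_tangential m p a : smooth p -> (forall d, vanish A m (partial d p)) ->
  (forall w, size w = m.+1 -> {in A, forall x, Z a (partials w p) x = 0}) ->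
  vanish A m.+1 (Z a p).
Proof.
elim: m p => [|m IH] p sp vp Zw.
all: have sdp d : smooth (partial d p) by exact: smooth_partial.
all: have sdc d b : smooth (partial d (partial a (c b))) by (do 2!apply: smooth_partial).
all: have sM d b : smooth (partial d (partial a (c b)) * partial b p) by exact: smoothM.
all: split; first by (move=> x Ax; rewrite [LHS]pointwiseE (vanish0 (vp a))// add0r
   pointwiseE fct_sumE big1 ?oppr0// => b _; rewrite pointwiseE (vanish0 (vp b))// mulr0).
all: move=> d; apply: (@vanish_eq _ (Z a (partial d p) - \sum_b partial d (partial a (c b)) * partial b p));
  first by (move=> x Ux; rewrite !pointwiseE tangential_partial// !pointwiseE addrK).
all: apply: vanishB; [exact: smooth_tangential|exact: smooth_sum| |
  by apply: vanish_sum => // b; exact: vanishM].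
  by split=> //; exact: (Zw [:: d]).
apply: IH => //.
- by move=> b; have [_ /(_ b)] := vp d.
- by move=> w sw; apply: (Zw (d :: w)); rewrite /= sw.
Qed.

End Retraction.

Lemma smooth_partials w p : smooth p -> smooth (partials w p).
Proof. by elim: w p => //= d w IH p sp; apply: IH; exact: smooth_partial. Qed.

Lemma vanish_partials m w p : (size w <= m)%N -> vanish A m p -> vanish A 0 (partials w p).
Proof.
elim: w m p => [|d w IH] [|m] p //= wm; try by move=> [].
by move=> [_ /(_ d)]; exact: IH.
Qed.

End VanishingOrder.

(** * Taylor bounds in the sup norm and covers of null sets *)

Section Taylor.
Context {R : realType} {m n : nat}.
Local Notation T := 'M[R]_(m, n).
Local Notation I := ('I_m * 'I_n)%type.
Implicit Types (f h p : T -> R) (x y z : T) (a b : I) (d K r : R).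

Definition unit_mx (a : I) : T := delta_mx a.1 a.2.
Local Notation partial := (partial unit_mx).
Local Notation partials := (partials unit_mx).
Local Notation smooth := (smooth unit_mx).

Lemma entry_le_norm x i j : `|x i j| <= `|x|.
Proof.
by rewrite [leRHS]/Num.Def.normr/= mx_normrE; exact: (le_bigmax _ _ (i, j)).
Qed.

Lemma norm_le_entries x r : 0 <= r -> (forall i j, `|x i j| <= r) -> `|x| <= r.
Proof.
move=> r0 H; rewrite [leLHS]/Num.Def.normr/= mx_normrE.
by apply: bigmax_le => // -[i j] _; exact: H.
Qed.

Lemma add_unit_mx k a x i j :
  (k *: unit_mx a + x) i j = (if (i, j) == a then k + x i j else x i j).
Proof.
by case: a => a1 a2; rewrite !mxE xpair_eqE /=; case: ifP => _; rewrite ?mulr1 ?mulr0 ?add0r.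
Qed.

(** Changing the entries one at a time keeps the path in the cube around
  [x], so that partial derivatives along the coordinates are enough. *)
Lemma mean_value f x d K :
  (forall z, `|z - x| <= d -> forall a, derivable f z (unit_mx a) /\ `|partial a f z| <= K) ->
  forall y, `|y - x| <= d -> `|f y - f x| <= #|{: I}|%:R * (K * d).
Proof.
move=> df; suff H s y : `|y - x| <= d ->
    (forall i j, (i, j) \notin s -> y i j = x i j) ->
    `|f y - f x| <= (size s)%:R * (K * d).
  move=> y yx; rewrite cardT; apply: H => // i j.
  by rewrite mem_enum.
elim: s y => [|a s IH] y yx ys.
  have -> : y = x by apply/matrixP => i j; exact: ys.
  by rewrite subrr normr0 mul0r.
have d0 : 0 <= d := le_trans (normr_ge0 _) yx.
have ed i j : `|y i j - x i j| <= d.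
  by have := entry_le_norm (y - x) i j; rewrite !mxE => /le_trans; apply.
pose k := y a.1 a.2 - x a.1 a.2.
pose y' := (- k) *: unit_mx a + y.
have y'E i j : y' i j = if (i, j) == a then x i j else y i j.
  rewrite add_unit_mx; case: eqP => // ija; rewrite /k -ija /=; ring.
have yE : y = k *: unit_mx a + y' by rewrite /y' scaleNr addrA subrr add0r.
have K0 : 0 <= K.
  have := (df x); rewrite subrr normr0 => /(_ d0 a)[_]; exact: le_trans.
have [c c01 E] : exists2 c, 0 <= c <= 1 &
    f y - f y' = k * partial a f ((c * k) *: unit_mx a + y') /\
    `|(c * k) *: unit_mx a + y' - x| <= d.
  have near t : 0 <= t <= 1 -> `|(t * k) *: unit_mx a + y' - x| <= d.
    move=> /andP[t0 t1]; apply: norm_le_entries => // i j.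
    rewrite mxE [X in _ + X]mxE add_unit_mx y'E; case: eqP => ija; last exact: ed.
    rewrite addrK normrM (ger0_norm t0) /k -ija /=.
    by apply: le_trans (ed i j); rewrite ler_piMl.
  have [|c c01 E] := @MVT_line _ _ f y' (unit_mx a) k.
    by move=> t /near /df /(_ a)[].
  by exists c => //; split; [rewrite {1}yE|exact: near].
have [{}E /df /(_ a)[_ Kc]] := E.
have -> : f y - f x = (f y - f y') + (f y' - f x) by rewrite addrA subrK.
apply: le_trans (ler_normD _ _) _.
rewrite /= -natr1 mulrDl mul1r addrC; apply: lerD.
  apply: IH => [|i j ijs]; last first.
    by rewrite y'E; case: eqP => // /eqP ija; apply: ys; rewrite inE negb_or ija.
  apply: norm_le_entries => // i j; rewrite mxE [X in _ + X]mxE y'E.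
  by case: ifP => _; rewrite ?subrr ?normr0.
by rewrite E normrM mulrC; apply: ler_pM => //; exact: ed.
Qed.

Lemma flat_bound U k h x d K : smooth U h -> vanish unit_mx [set x] k h ->
  (forall z, `|z - x| <= d -> U z) ->
  (forall w z, size w = k.+1 -> `|z - x| <= d -> `|partials w h z| <= K) ->
  forall y, `|y - x| <= d -> `|h y| <= (#|{: I}|%:R * d) ^+ k.+1 * K.
Proof.
elim: k h => [|k IH] h sh vh Ud Hw y yx.
all: have hx : h x = 0 by apply: (vanish0 vh); rewrite inE.
all: rewrite -[h y]subr0 -hx.
  apply: le_trans (mean_value (K := K) _ yx) _; last by rewrite expr1 [K * d]mulrC mulrA.
  move=> z zx a; split; first exact: smooth_derivable (sh) (Ud _ zx).
  exact: (Hw [:: a]).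
apply: le_trans (mean_value (K := (#|{: I}|%:R * d) ^+ k.+1 * K) _ yx) _; last first.
  rewrite [_ ^+ k.+2]exprS; move: (_ ^+ k.+1) => P.
  by rewrite le_eqVlt; apply/orP; left; apply/eqP; ring.
move=> z zx a; split; first exact: smooth_derivable (sh) (Ud _ zx).
apply: IH => //; first exact: smooth_partial.
  by have [_ /(_ a)] := vh.
by move=> w u sw ux; apply: (Hw (a :: w)) => //=; rewrite sw.
Qed.

End Taylor.

Section Negligible.
Context {R : realType}.
Local Notation mu := (@lebesgue_measure R).

Lemma negligible_small (B : set R) :
  (forall eps : R, 0 < eps -> exists D, [/\ measurable D, B `<=` D & (mu D <= eps%:E)%E]) ->
  mu.-negligible B.
Proof.
move=> H; have e0 k : 0 < k.+1%:R^-1 :> R by rewrite invr_gt0.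
pose D k := sval (cid (H _ (e0 k))).
have HD k : [/\ measurable (D k), B `<=` D k & (mu (D k) <= (k.+1%:R^-1)%:E)%E].
  exact: svalP (cid (H _ (e0 k))).
exists (\bigcap_k D k); split.
- by apply: bigcapT_measurable => k; have [] := HD k.
- apply/eqP; rewrite eq_le measure_ge0 andbT.
  apply/lee_addgt0Pr => eps eps0; rewrite add0e.
  have [k] := ltr_add_invr eps0; rewrite add0r => /ltW keps.
  have [mD _ Dle] := HD k.
  apply: (@le_trans _ _ (mu (D k))).
    apply: le_measure; rewrite ?inE//; last exact: bigcap_inf.
    by apply: bigcapT_measurable => j; have [] := HD j.
  by apply: le_trans Dle _; rewrite lee_fin.
- by move=> x Bx k _; have [_ + _] := HD k; apply.
Qed.

Lemma negligible_finType (J : finType) (F : J -> set R) (B : set R) :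
  (forall j, mu.-negligible (F j)) -> (forall x, B x -> exists j, F j x) ->
  mu.-negligible B.
Proof.
move=> nF BF; have BU : B `<=` \big[setU/set0]_j F j.
  by move=> x /BF[j Fj]; rewrite (bigD1 j)//=; left.
apply: (@negligibleS _ (measurableTypeR R) _ lebesgue_measure _ _ BU); elim/big_ind : _ => //; first exact: negligible_set0.
by move=> P Q; exact: negligibleU.
Qed.

Lemma measure_union_intervals (J : finType) (t : J -> R) (P : pred J) (d : R) : 0 <= d ->
  let D := \big[setU/set0]_(j | P j) `[t j - d, t j + d]%classic in
  measurable D /\ (mu D <= (#|J|%:R * (2 * d))%:E)%E.
Proof.
move=> d0 D.
have mI j : measurable `[t j - d, t j + d]%classic by exact: measurable_itv.
split; first by apply: bigsetU_measurable => j _.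
pose F j : set R := `[t j - d, t j + d]%classic.
have muF j : (mu (F j) <= (2 * d)%:E)%E.
  rewrite /F lebesgue_measure_itv/= lte_fin; case: ifP => _; last by rewrite lee_fin mulr_ge0.
  by rewrite -EFinD lee_fin; lra.
suff H (s : seq J) : (mu (\big[setU/set0]_(j <- s | P j) F j)
    <= ((size s)%:R * (2 * d))%:E)%E.
  by apply: le_trans (H _) _; rewrite /index_enum -enumT -cardE.
elim: s => [|j s IH]; first by rewrite big_nil measure0 mul0r.
rewrite big_cons; case: ifP => _; last first.
  by apply: le_trans IH _; rewrite lee_fin ler_wpM2r ?mulr_ge0// ler_nat.
apply: le_trans (measureU2 _ _ _) _; [exact: mI| |].
  by apply: bigsetU_measurable => j' _; exact: mI.
rewrite -[(size (j :: s))]/((size s).+1) -natr1 addrC mulrDl mul1r EFinD; apply: leeD => //.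
exact: muF.
Qed.

End Negligible.

(** * Sard's theorem for real-valued functions *)

Section Sard.
Context {R : realType} {m n : nat}.
Local Notation T := 'M[R]_(m, n).
Local Notation I := ('I_m * 'I_n)%type.
Implicit Types (f h p : T -> R) (x y z : T) (a b : I) (A U : set T) (k : nat).
Local Notation mu := (@lebesgue_measure R).
Local Notation partial := (partial (@unit_mx R m n)).
Local Notation partials := (partials (@unit_mx R m n)).
Local Notation smooth := (smooth (@unit_mx R m n)).
Local Notation vanish := (vanish (@unit_mx R m n)).
Local Notation N := #|{: I}|.

Lemma truncn_eq_dist (s t : R) : 0 <= s -> 0 <= t ->
  Num.truncn s = Num.truncn t -> `|s - t| <= 1.
Proof.
move=> /truncn_itv/andP[s1 s2] /truncn_itv/andP[t1 t2] st.
rewrite st in s1 s2; rewrite -natr1 in s2 t2.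
by rewrite ler_norml; apply/andP; split; lra.
Qed.

(** At mesh [l^-1] there are [O(l ^ N)] cells, and each has an image of
  diameter [O(l ^- N.+1)]. *)
Lemma negligible_holder A p (C : R) k : (0 < k)%N -> 0 <= C ->
  (forall x, A x -> `|x| <= k%:R) ->
  (forall x y d, A x -> A y -> `|y - x| <= d -> d <= k%:R^-1 ->
    `|p y - p x| <= C * d ^+ N.+1) ->
  mu.-negligible (p @` A).
Proof.
move=> k0 C0 Ak Hp; apply: negligible_small => eps eps0.
(* the total length of the cover at mesh l^-1 is at most X * eps / l *)
pose X := (3 * k%:R) ^+ N * (2 * C) / eps.
have X0 : 0 <= X by rewrite divr_ge0 ?mulr_ge0 ?exprn_ge0 ?mulr_ge0 ?ler0n// ltW.
pose l := maxn k (Num.Def.archi_bound X).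
have lk : (k <= l)%N := leq_maxl _ _.
have l0 : (0 < l)%N := leq_trans k0 lk.
have lX : X <= l%:R.
  by apply: le_trans (ltW (archi_boundP X0)) _; rewrite ler_nat leq_maxr.
have kR0 : 0 < k%:R :> R by rewrite ltr0n.
have lR0 : 0 < l%:R :> R by rewrite ltr0n.
pose u x (a : I) := Num.truncn ((x a.1 a.2 + k%:R) * l%:R).
pose M := (2 * k * l).+1.
pose cell (c : {ffun I -> 'I_M}) := [set x | A x /\ forall a, u x a = c a].
pose t c := p (xget 0 (cell c)).
pose P := fun c => `[< cell c !=set0 >].
pose d := C * (l%:R^-1) ^+ N.+1.
have d0 : 0 <= d by rewrite mulr_ge0// exprn_ge0// invr_ge0 ltW.
have [mD muD] := measure_union_intervals t P d0.
have xk x a : A x -> 0 <= (x a.1 a.2 + k%:R) * l%:R <= (2 * k * l)%:R.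
  move=> /Ak xk; have := le_trans (entry_le_norm x a.1 a.2) xk.
  rewrite ler_norml natrM [(2 * k)%:R]natrM.
  move: (x _ _) => r /andP[x1 x2]; apply/andP; split.
    by apply: mulr_ge0; [lra|exact: ltW].
  by apply: ler_wpM2r; [exact: ltW|lra].
exists (\big[setU/set0]_(c | P c) `[t c - d, t c + d]%classic); split=> //.
  move=> _ [x Ax <-]; pose c := [ffun a => inord (u x a) : 'I_M].
  have cx : cell c x.
    split=> // a; rewrite ffunE inordK// ltnS.
    have /andP[h1 h2] := xk x a Ax.
    by rewrite -(ler_nat R); apply: le_trans h2; rewrite truncn_le.
  have Pc : P c by apply/asboolP; exists x.
  rewrite (bigD1 c)//=; left => /=; rewrite in_itv/=.
  have [Ay yc] : cell c (xget 0 (cell c)) by apply: xgetPex; exists x.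
  have : `|p x - t c| <= d.
    apply: Hp => //; last by rewrite lef_pV2 ?posrE// ler_nat.
    apply: norm_le_entries => [|i j]; first by rewrite invr_ge0 ltW.
    move: Ay yc; set y := xget _ _ => Ay yc; rewrite !mxE.
    have /andP[h1 _] := xk x (i, j) Ax; have /andP[h2 _] := xk y (i, j) Ay.
    have := truncn_eq_dist h1 h2; rewrite -!/(u _ (i, j)) yc.
    have [_ ->] := cx => /(_ erefl) /=.
    rewrite -mulrBl opprD addrACA subrr addr0 normrM [`|l%:R|]ger0_norm ?ler0n//.
    by rewrite -ler_pdivlMr// mul1r.
  by rewrite ler_norml; move: (p x) (t c) => r s /andP[]; lra.
apply: le_trans muD _; rewrite lee_fin card_ffun card_ord.
have MN : (M ^ N)%:R <= (3 * k%:R * l%:R) ^+ N :> R.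
  rewrite natrX; apply: lerXn2r; rewrite ?nnegrE ?mulr_ge0 ?ler0n//.
  rewrite -!natrM ler_nat /M -!mulnA.
  by have : (0 < k * l)%N by [rewrite muln_gt0 k0]; move: (k * l)%N => q; lia.
apply: le_trans (ler_wpM2r _ MN) _; first by rewrite mulr_ge0.
rewrite exprMn /d exprSr exprVn.
rewrite [leLHS](_ : _ = X * eps / l%:R).
  by rewrite ler_pdivrMr// mulrC ler_wpM2l// ltW.
rewrite /X divfK ?gt_eqF//.
have : l%:R ^+ N != 0 :> R by rewrite expf_neq0// gt_eqF.
have : l%:R != 0 :> R by rewrite gt_eqF.
move: (l%:R) (l%:R ^+ N) => r s r0 s0; field.
by rewrite r0 s0.
Qed.

Lemma vanishS A A' k h : A' `<=` A -> vanish A k h -> vanish A' k h.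
Proof.
move=> A'A; have iA x : x \in A' -> x \in A by rewrite !inE; exact: A'A.
elim: k h => [|k IH] h [h0 dh]; split=> //; try by move=> x /iA /h0.
by move=> a; apply: IH (dh a).
Qed.

(** Around the points of [A] the derivatives of order [N.+2] of [p] are bounded,
  but not uniformly; [A] is a countable union of pieces where the bound and the
  radius are uniform, and Taylor's formula applies on each of them. *)
Lemma negligible_flat U A p : open U -> A `<=` U -> smooth U p ->
  (forall a, vanish A N (partial a p)) -> mu.-negligible (p @` A).
Proof.
move=> oU AU sp vp.
pose A_ k := [set x | [/\ A x, `|x| <= k.+1%:R &
  forall z, `|z - x| <= k.+1%:R^-1 ->
    U z /\ forall w : N.+2.-tuple I, `|partials w p z| <= k.+1%:R]].
have AA x : A x -> exists k, A_ k x.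
  move=> Ax; have Ux := AU x Ax.
  have : \forall z \near x, U z /\ forall w : N.+2.-tuple I,
      `|partials w p z| <= `|partials w p x| + 1.
    apply: filterI; first exact: (open_near oU Ux).
    apply: (@filter_forall _ _ (fun (w : N.+2.-tuple I) z =>
      `|partials w p z| <= `|partials w p x| + 1) (nbhs x)) => w.
    have /cvgrPdist_le : {for x, continuous (partials w p)}.
      by apply: smooth_continuous Ux; exact: smooth_partials.
    move=> /(_ 1 ltr01); apply: filterS => z.
    move: (partials w p x) (partials w p z) => r s h; rewrite -{1}(subKr r s).
    by apply: le_trans (ler_normB _ _) _; rewrite lerD2l.
  move=> /nbhs_ballP[r /= r0 Hr].
  have : \forall k \near \oo, [/\ `|x| <= k.+1%:R :> R, k.+1%:R^-1 < r &
      forall w : N.+2.-tuple I, `|partials w p x| + 1 <= k.+1%:R].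
    have large (t : R) : \forall k \near \oo, t <= k.+1%:R.
      apply: filterS (nbhs_infty_ger t) => j /= tj.
      by apply: le_trans tj _; rewrite ler_nat.
    apply: filterS3 (fun k => @And3 _ _ _) _ _ _.
    - exact: large.
    - exact: (near_infty_natSinv_lt (PosNum r0)).
    - exact: (@filter_forall _ _ (fun (w : N.+2.-tuple I) k =>
      `|partials w p x| + 1 <= k.+1%:R) \oo _ (fun w => large _)).
  move=> /filter_ex[k [xk rk wk]]; exists k; split=> // z zx.
  have /Hr[Uz Hz] : (ball x r) z by rewrite -ball_normE /= distrC; exact: le_lt_trans rk.
  by split=> // w; exact: le_trans (Hz w) (wk w).
have Ap : p @` A `<=` \bigcup_k (p @` A_ k).
  by move=> _ [x /AA[k Akx] <-]; exists k => //; exists x.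
apply: (@negligibleS _ (measurableTypeR R) _ lebesgue_measure _ _ Ap).
apply: negligible_bigcup => k.
apply: (@negligible_holder _ _ (N%:R ^+ N.+2 * k.+1%:R) k.+1) => //.
  by move=> x [].
move=> x y d [Ax xk Hx] _ yx dk.
have d0 : 0 <= d := le_trans (normr_ge0 _) yx.
have d1 : d <= 1 by apply: le_trans dk _; rewrite invf_le1 ?ltr0n// ler1n.
pose K := (N%:R * d) ^+ N.+1 * k.+1%:R.
apply: le_trans (mean_value (K := K) _ yx) _.
  move=> z zx a; split.
    by apply: smooth_derivable sp _; have [] := Hx z (le_trans zx dk).
  apply: (@flat_bound _ _ _ U) zx.
  - exact: smooth_partial.
  - by apply: vanishS (vp a) => _ ->.
  - by move=> z' zx'; have [] := Hx z' (le_trans zx' dk).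
  - move=> w z' sw zx'; have [_ Hw] := Hx z' (le_trans zx' dk).
    have sw' : size (a :: w) == N.+2 by rewrite /= sw.
    exact: (Hw (Tuple sw')).
rewrite /K exprMn [leLHS](_ : _ = N%:R ^+ N.+2 * k.+1%:R * (d ^+ N.+1 * d)).
  apply: ler_wpM2l; first by rewrite mulr_ge0 ?exprn_ge0 ?ler0n.
  by apply: ler_piMr => //; exact: exprn_ge0.
rewrite [N%:R ^+ N.+2]exprS; move: (_ ^+ N.+1) (d ^+ _) => P Q; ring.
Qed.

(** [c] encodes the map [x |-> x - c x], which fixes [A] pointwise; its
  differential along [A] kills the directions outside [B]. *)
Definition retraction U A (c : I -> T -> R) (B : {set I}) : Prop :=
  [/\ forall b, smooth U (c b), forall b, vanish A 0 (c b) &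
      forall a b, a \notin B -> {in A, forall x, partial a (c b) x = (b == a)%:R}].

Local Notation Z := (tangential (@unit_mx R m n)).
Local Notation E := (field_along (@unit_mx R m n)).

Lemma tangential0 U A c B a h x : retraction U A c B -> a \notin B -> A x ->
  Z c a h x = 0.
Proof.
move=> [_ _ cB] aB Ax; rewrite /tangential !pointwiseE fct_sumE (bigD1 a)//= pointwiseE cB ?inE//.
rewrite eqxx mul1r big1 ?addr0 ?subrr// => b ba.
by rewrite pointwiseE cB ?inE// (negbTE ba) mul0r.
Qed.

(** The function [h] becomes a new transversal coordinate.  With [y] the
  tangential vector field normalised so that [h] has derivative 1 along it, the
  new displacement is [c + (h - E h) y]; the correcting factor [h - E h] removes
  from [h] the part of its variation that [c] already accounts for. *)
Lemma retraction_step U A c B a h : open U -> A `<=` U -> retraction U A c B ->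
  smooth U h -> vanish A 0 h -> (forall x, A x -> Z c a h x != 0) ->
  exists U' c', [/\ open U', A `<=` U', U' `<=` U & retraction U' A c' (B :\ a)].
Proof.
move=> oU AU rc0 sh vh Zh; have [sc vc cB] := rc0.
have sE := smooth_field_along oU sc sh; have sZ := smooth_tangential oU sc a sh.
pose U' := U `&` [set x | Z c a h x != 0].
have U'U : U' `<=` U by move=> x [].
have oU' : open U'.
  rewrite openE => x [Ux Zx]; apply: filterI; first exact: (open_near oU Ux).
  have cZ : {for x, continuous (Z c a h)} := smooth_continuous sZ Ux.
  apply: (cZ [set t | t != 0]).
  by apply: open_nbhs_nbhs; split; [exact: open_neq|exact: Zx].
have AU' : A `<=` U' by move=> x Ax; split; [exact: AU|exact: Zh].
pose y b := (cst (b == a)%:R - partial a (c b)) * (fun x => (Z c a h x)^-1).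
have sy b : smooth U' (y b).
  apply: smoothM => //.
    apply: smoothB => //; first exact: smooth_cst.
    exact: smoothS (smooth_partial a (sc b)).
  by apply: smoothV => //; [exact: smoothS sZ|move=> x []].
have shE : smooth U' (h - E c h) by apply: smoothB => //; exact: smoothS U'U _.
exists U', (fun b => c b + (h - E c h) * y b); split=> //; split=> [b|b|d b].
- apply: smoothD => //; first exact: smoothS (sc b).
  exact: smoothM.
- split=> // x Ax; rewrite !pointwiseE (field_along0 vc)// (vanish0 vh)// (vanish0 (vc b))//; ring.
rewrite !inE negb_and negbK => dB x; rewrite inE => Ax.
have Ux : x \in U' by rewrite inE; exact: AU'.
have Ux' : x \in U by rewrite inE; exact: AU.
rewrite (partialD _ _ _ Ux); [|exact: smoothS (sc b)|exact: smoothM].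
rewrite pointwiseE (partialM _ _ _ Ux)// !pointwiseE (field_along0 vc) ?inE// (vanish0 vh) ?inE//.
rewrite subrr mul0r addr0 (partialB _ sh sE Ux') !pointwiseE (partial_field_along oU sc d sh Ux') !pointwiseE.
rewrite (field_along0 vc) ?inE// add0r opprB addrCA subrr addr0 /y !pointwiseE.
move: dB => /orP[/eqP->|dB].
  by rewrite mulrC divfK ?Zh// addrCA subrr addr0.
by rewrite (tangential0 h rc0 dB Ax) mul0r addr0 cB ?inE.
Qed.

(** Either all the tangential derivatives needed to flatten [p] further vanish, or
  one of them yields a function to which [retraction_step] applies. *)
Lemma sard_split U A f c B : open U -> A `<=` U -> smooth U f ->
  (forall a, vanish A 0 (partial a f)) -> retraction U A c B ->
  (forall a U' A' c', a \in B -> open U' -> A' `<=` U' -> smooth U' f ->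
    (forall a, vanish A' 0 (partial a f)) -> retraction U' A' c' (B :\ a) ->
    mu.-negligible (f @` A')) ->
  mu.-negligible (f @` A).
Proof.
move=> oU AU sf vf rc IH; have [sc vc cB] := rc.
suff H j : forall r A' p, (r + j = N)%N -> A' `<=` A -> smooth U p ->
    {in A', p =1 f} -> (forall a, vanish A' r (partial a p)) -> mu.-negligible (f @` A').
  exact: (H N 0%N A f).
(* p is f flattened to order r on A'; j orders remain to be gained *)
elim: j => [|j IHj] r A' p rj A'A sp pf vp.
all: have A'U : A' `<=` U by exact: subset_trans A'A AU.
  rewrite (_ : f @` A' = p @` A').
    by apply: (negligible_flat oU) => // a; rewrite -rj addn0; exact: vp.
  by apply/seteqP; split=> _ [x A'x <-]; exists x; rewrite // pf ?inE.
pose A1 := [set x | A' x /\ forall (w : r.+1.-tuple I) a, Z c a (partials w p) x = 0].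
pose Aw (wa : (r.+1.-tuple I) * I) := [set x | A' x /\ Z c wa.2 (partials wa.1 p) x != 0].
have A1A' : A1 `<=` A' by move=> x [].
have A1U : A1 `<=` U by exact: subset_trans A1A' A'U.
have nA1 : mu.-negligible (f @` A1).
  have vc1 b : vanish A1 0 (c b) by apply: vanishS (vc b); exact: subset_trans A'A.
  have vp1 a : vanish A1 r (partial a p) by exact: vanishS (vp a).
  have [a|q [sq qp vq]] := vanish_flatten oU A1U sc vc1 sp vp1.
    apply: (vanish_tangential oU A1U sc sp vp1) => w sw x; rewrite inE => -[_].
    by move: sw => /eqP sw; move=> /(_ (Tuple sw) a).
  apply: IHj sq _ vq; first by rewrite addSnnS.
    exact: subset_trans A'A.
  by move=> x A1x; rewrite qp// pf//; move: A1x; rewrite !inE => /A1A'.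
have nAw wa : mu.-negligible (f @` Aw wa).
  case: wa => w a.
  have AwA' : Aw (w, a) `<=` A' by move=> x [].
  have AwA : Aw (w, a) `<=` A by exact: subset_trans A'A.
  have AwU : Aw (w, a) `<=` U by exact: subset_trans AU.
  have rw : retraction U (Aw (w, a)) c B.
    split=> // [b|d b dB x]; first exact: vanishS (vc b).
    by rewrite inE => /AwA Ax; apply: cB; rewrite ?inE.
  have [aB|aB] := boolP (a \in B); last first.
    rewrite (_ : Aw (w, a) = set0) ?image_set0; first exact: negligible_set0.
    by rewrite -subset0 => x [/A'A Ax /=]; rewrite (tangential0 _ rc)// eqxx.
  have sh : smooth U (partials w p) by exact: smooth_partials.
  have vh : vanish (Aw (w, a)) 0 (partials w p).
    case/tupleP: w {AwA' AwA AwU rw sh} => b w'; apply: (@vanishS A'); first by move=> x [].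
    by apply: (vanish_partials (m := r)) (vp b); rewrite size_tuple.
  have [|U' [c' [oU' AwU' U'U rc']]] := retraction_step (a := a) oU AwU rw sh vh.
    by move=> x [].
  apply: IH aB oU' AwU' _ _ rc'; first exact: smoothS sf.
  by move=> b; exact: vanishS (vf b).
apply: (@negligible_finType _ (option ((r.+1.-tuple I) * I))
  (fun o => if o is Some wa then f @` Aw wa else f @` A1)); first by case.
move=> _ [x A'x <-].
have [A1x|] := pselect (A1 x); first by exists None; exists x.
move=> nA1x; have [[w a] wax] : exists wa, Aw wa x.
  apply: contrapT => nAwx; apply: nA1x; split=> // w a.
  by apply/eqP; apply: contrapT => /negP Zx; apply: nAwx; exists (w, a).
by exists (Some (w, a)); exists x.
Qed.

(** The number of tangential directions decreases; at first all are tangential,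
  and the displacement is zero. *)
Theorem sard U A f : open U -> A `<=` U -> smooth U f ->
  (forall a, {in A, forall x, partial a f x = 0}) -> mu.-negligible (f @` A).
Proof.
move=> oU AU sf f0.
suff H k : forall (B : {set I}) U A c, (#|B| <= k)%N -> open U -> A `<=` U -> smooth U f ->
    (forall a, vanish A 0 (partial a f)) -> retraction U A c B -> mu.-negligible (f @` A).
  apply: (H N [set: I]%SET U A (fun=> cst 0)) => //; first exact: max_card.
  by split=> [b|b|a b]; [exact: smooth_cst|split|rewrite inE].
elim: k {U A oU AU sf f0} => [|k IHk] B U A c Bk oU AU sf vf rc.
all: apply: (sard_split oU AU sf vf rc) => a U' A' c' aB.
  by move: Bk; rewrite leqn0 cards_eq0 => /eqP B0; rewrite B0 inE in aB.
by apply: IHk; move: Bk; rewrite (cardsD1 a) aB.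
Qed.

End Sard.

(** * The gradient of the vortex energy *)

Section Entries.
Context {R : realType} {m n : nat}.
Local Notation T := 'M[R]_(m, n).
Implicit Types (U : set T).

Lemma is_derive_entry (x v : T) i j :
  is_derive x v (fun y : T => y i j) (v i j).
Proof.
apply: derivable_lineP.
rewrite (_ : (fun _ => _) = (v i j *: @idfun R + cst (x i j))).
  by apply: is_derive_eq; rewrite addr0 [_%:A]mulr1.
by apply/funext => s; rewrite !mxE mulrC.
Qed.

Lemma partial_entry a i j (x : T) :
  partial (@unit_mx R m n) a (fun y : T => y i j) x = ((i, j) == a)%:R.
Proof.
rewrite partialE; have D := is_derive_entry x (@unit_mx R m n a) i j.
by rewrite [LHS]derive_val mxE; case: a {D} => a1 a2; rewrite xpair_eqE.
Qed.

Lemma smooth_entry U i j : smooth (@unit_mx R m n) U (fun y : T => y i j).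
Proof.
apply: smooth_bootstrap => [x _|a x _|k _ a].
- exact: coord_continuous.
- by have [] := is_derive_entry x (@unit_mx R m n a) i j.
rewrite (_ : partial _ a _ = cst ((i, j) == a)%:R); first exact: Ck_cst.
by apply/funext => x; rewrite partial_entry.
Qed.

End Entries.

Section Vortices.
Context {R : realType} {N : nat} (Gamma : 'I_N -> R).
Local Notation T := 'M[R]_(2, N).
Implicit Types (x y : T) (i j l : 'I_N) (a : 'I_2).
Local Notation partial := (partial (@unit_mx R 2 N)).
Local Notation smooth := (smooth (@unit_mx R 2 N)).
Local Notation U := (~` @collision R N).

Definition sqdist i j x : R := sqnorm (col i x - col j x).

Definition incidence i j l : R := (l == i)%:R - (l == j)%:R.

Lemma sqdistE i j : sqdist i j = 
  \sum_k ((fun x : T => x k i) - (fun x : T => x k j)) * ((fun x : T => x k i) - (fun x : T => x k j)).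
Proof.
by apply/funext => x; rewrite fct_sumE /sqdist /sqnorm; apply: eq_bigr => k _; rewrite !mxE !pointwiseE expr2.
Qed.

Lemma sqdist_sum i j x : sqdist i j x = \sum_k (x k i - x k j) ^+ 2.
Proof. by rewrite /sqdist /sqnorm; apply: eq_bigr => k _; rewrite !mxE. Qed.

Lemma smooth_sqdist W i j : open W -> smooth W (sqdist i j).
Proof.
move=> oW; rewrite sqdistE; apply: smooth_sum => // k _.
by apply: smoothM => //; apply: smoothB => //; exact: smooth_entry.
Qed.

Lemma partial_sqdist a l i j x :
  partial (a, l) (sqdist i j) x = 2 * (x a i - x a j) * incidence i j l.
Proof.
have oT : open [set: T] := openT; have xT : x \in [set: T] by rewrite inE.
have sf k p : smooth setT (fun y : T => y k p) by exact: smooth_entry.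
rewrite sqdistE (partial_sum oT); [|by move=> k _; apply: smoothM => //; exact: smoothB|by []].
rewrite fct_sumE (bigD1 a)//= big1 ?addr0 => [|k ka].
  rewrite (partialM (U := setT)) ?inE//; do ?exact: smoothB.
  by rewrite !pointwiseE (partialB (U := setT))// !pointwiseE !partial_entry !xpair_eqE eqxx /= /incidence ![_ == l]eq_sym; ring.
rewrite (partialM (U := setT)) ?inE//; do ?exact: smoothB.
by rewrite !pointwiseE (partialB (U := setT))// !pointwiseE !partial_entry !xpair_eqE (negbTE ka) /=; ring.
Qed.

Lemma sqdist_ge0 i j x : 0 <= sqdist i j x.
Proof. by rewrite sqdist_sum sumr_ge0// => k _; exact: sqr_ge0. Qed.

Lemma sqdist_eq0 i j x : sqdist i j x = 0 <-> col i x = col j x.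
Proof.
split=> [|ij]; last by rewrite /sqdist ij subrr /sqnorm big1// => k _; rewrite mxE expr0n.
rewrite sqdist_sum => /eqP; rewrite psumr_eq0; last by move=> k _; exact: sqr_ge0.
move=> /allP d0; apply/matrixP => k u; rewrite !mxE; apply/eqP.
by have := d0 k (mem_index_enum _); rewrite sqrf_eq0 subr_eq0.
Qed.

Lemma sqdist_gt0 i j x : U x -> (i < j)%N -> 0 < sqdist i j x.
Proof.
move=> Ux ij; rewrite lt_neqAle sqdist_ge0 andbT eq_sym; apply/eqP => /sqdist_eq0 cij.
by apply: Ux; exists i, j.
Qed.

Lemma noncollisionP x : U x <-> forall i j, (i < j)%N -> 0 < sqdist i j x.
Proof.
split=> [Ux i j|d0 [i [j [ij /sqdist_eq0 dij]]]]; first exact: sqdist_gt0.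
by have := d0 i j ij; rewrite dij ltxx.
Qed.

Lemma continuous_sqdist i j : continuous (sqdist i j).
Proof. by move=> x; apply: (smooth_continuous (smooth_sqdist i j openT)). Qed.

Lemma open_noncollision : open U.
Proof.
rewrite openE => x /noncollisionP Ux.
have : \forall y \near x, forall ij : 'I_N * 'I_N, (ij.1 < ij.2)%N -> 0 < sqdist ij.1 ij.2 y.
  apply: (@filter_forall _ _ (fun (ij : 'I_N * 'I_N) y => (ij.1 < ij.2)%N -> 0 < sqdist ij.1 ij.2 y) (nbhs x)) => -[i j] /=.
  case: (boolP (i < j)%N) => ij; last by apply: nearW.
  have H : \forall y \near x, 0 < sqdist i j y.
    exact: cvgr_gt (@continuous_sqdist i j x) _ (Ux i j ij).
  by apply: filterS H.
by apply: filterS => y Hy; apply/noncollisionP => i j; exact: (Hy (i, j)).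
Qed.

Definition pair_sum (F : 'I_N -> 'I_N -> R) : R :=
  \sum_(i < N) \sum_(j < N | (i < j)%N) Gamma i * Gamma j * F i j.

Definition vortex_gradient x : T := \matrix_(a, l)
  (- (2 * pi)^-1 * pair_sum (fun i j => (x a i - x a j) * incidence i j l / sqdist i j x)).

Lemma energyE : energy Gamma = - (4 * pi)^-1 *:
  \sum_(i < N) \sum_(j < N | (i < j)%N) (Gamma i * Gamma j) *: (fun x => ln (sqdist i j x)).
Proof.
apply/funext => x; rewrite pointwiseE fct_sumE /energy; congr (_ * _).
by apply: eq_bigr => i _; rewrite fct_sumE.
Qed.

Lemma smooth_energy : smooth U (energy Gamma).
Proof.
have oU := open_noncollision.
rewrite energyE; apply: smoothZ => //; apply: smooth_sum => // i _.
apply: smooth_sum => // j ij; apply: smoothZ => //.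
apply: (smooth_ln oU _ _).1; first exact: smooth_sqdist.
by move=> x Ux; exact: sqdist_gt0.
Qed.

Lemma partial_energy a l x : U x -> partial (a, l) (energy Gamma) x = vortex_gradient x a l.
Proof.
move=> Ux; have oU := open_noncollision; have xU : x \in U by rewrite inE.
have ln' i j : (i < j)%N -> smooth U (fun x => ln (sqdist i j x)) /\
    forall b x, U x -> partial b (fun x => ln (sqdist i j x)) x = partial b (sqdist i j) x / sqdist i j x.
  move=> ij; apply: smooth_ln => //; first exact: smooth_sqdist.
  by move=> y Uy; exact: sqdist_gt0.
have sl i j : (i < j)%N -> smooth U ((Gamma i * Gamma j) *: (fun x => ln (sqdist i j x))).
  by move=> ij; apply: smoothZ => //; exact: (ln' i j ij).1.
have ssl i : smooth U (\sum_(j < N | (i < j)%N) (Gamma i * Gamma j) *: (fun x => ln (sqdist i j x))).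
  by apply: smooth_sum => // j; exact: sl.
rewrite energyE (partialZ (U := U))//; last by apply: smooth_sum.
rewrite pointwiseE (partial_sum oU)// fct_sumE mxE /pair_sum.
rewrite (_ : (4 * pi)^-1 = (2 * pi)^-1 / 2 :> R); last first.
  have : pi != 0 :> R by rewrite gt_eqF ?pi_gt0.
  by move: (@pi R) => q q0; field.
rewrite -mulNr -mulrA; congr (_ * _); rewrite mulr_sumr; apply: eq_bigr => i _.
rewrite (partial_sum oU)//; last by move=> j; exact: sl.
rewrite fct_sumE mulr_sumr; apply: eq_bigr => j ij.
rewrite (partialZ (U := U))//; last exact: (ln' i j ij).1.
rewrite pointwiseE (ln' i j ij).2// partial_sqdist.
by move: (incidence _ _ _) ((sqdist i j x)^-1) => r s; lra.
Qed.

Lemma gradient_energy x : U x -> gradient (energy Gamma) x = vortex_gradient x.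
Proof.
by move=> Ux; apply/matrixP => a l; rewrite -partial_energy// mxE.
Qed.

Lemma ang_impulseE x : ang_impulse Gamma x = \sum_l Gamma l * \sum_a x a l ^+ 2.
Proof.
by apply: eq_bigr => l _; congr (_ * _); apply: eq_bigr => a _; rewrite mxE.
Qed.

End Vortices.

(** * Relative equilibria as solutions of an algebraic system *)

Section Rotation.
Context {R : realType}.

Definition rotation (t : R) : 'M[R]_2 := cos t *: 1 + sin t *: J2 R.

Lemma rotation_mulmx n t (x : 'M[R]_(2, n)) :
  rotation t *m x = cos t *: x + sin t *: (J2 R *m x).
Proof. by rewrite mulmxDl -!scalemxAl mul1mx. Qed.

Lemma J2_mulmxK n (x : 'M[R]_(2, n)) : J2 R *m (J2 R *m x) = - x.
Proof. by rewrite mulmxA -[_ *m J2 R]/(J2 R * J2 R) J2_sqr mulNmx mul1mx. Qed.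

Lemma rotation_J2 n t (x : 'M[R]_(2, n)) : J2 R *m (rotation t *m x) = rotation t *m (J2 R *m x).
Proof. by rewrite !rotation_mulmx mulmxDr -!scalemxAr. Qed.

Lemma col_mulmx n (A : 'M[R]_2) i (x : 'M[R]_(2, n)) : col i (A *m x) = A *m col i x.
Proof. by rewrite !colE mulmxA. Qed.

Lemma sqnorm_rotation t (v : 'cV[R]_2) : sqnorm (rotation t *m v) = sqnorm v.
Proof.
rewrite rotation_mulmx /sqnorm !big_ord_recl !big_ord0 !mxE !big_ord_recl !big_ord0 !mxE /=.
rewrite !(mulr0, mul0r, addr0, add0r, subr0, sub0r, mulN1r, mul1r) /=.
have := cos2Dsin2 t; move: (cos t) (sin t) (v ord0 0) (v (lift _ _) 0) => c s p q cs.
by transitivity ((c ^+ 2 + s ^+ 2) * (p ^+ 2 + q ^+ 2)); [ring|rewrite cs mul1r].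
Qed.

Lemma is_derive_rotation n w t (x : 'M[R]_(2, n)) :
  is_derive t (1 : R) (fun s : R => rotation (w * s) *m x) (w *: (J2 R *m (rotation (w * t) *m x))).
Proof.
have dw : is_derive t (1 : R) (fun s : R => w * s) w.
  rewrite (_ : (fun _ => _) = w *: (@idfun R)); last by apply/funext.
  by apply: is_derive_eq; rewrite [_%:A]mulr1.
have D a i : is_derive t (1 : R) (fun s : R => (rotation (w * s) *m x) a i)
    ((w *: (J2 R *m (rotation (w * t) *m x))) a i).
  rewrite (_ : (fun _ => _) = x a i *: (@cos R \o (fun s => w * s)) +
      (J2 R *m x) a i *: (@sin R \o (fun s => w * s))); last first.
    by apply/funext => s; rewrite rotation_mulmx !mxE /= !pointwiseE mulrC; congr (_ + _); rewrite mulrC.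
  apply: is_derive_eq.
  rewrite rotation_J2 rotation_mulmx J2_mulmxK !mxE /GRing.scale/=; ring.
have dz : derivable (fun s : R => rotation (w * s) *m x) t 1.
  by apply/derivable_mxP => a i; have [] := D a i.
apply: DeriveDef => //; rewrite derive_mx//.
by apply/matrixP => a i; rewrite mxE; have Dai := D a i; rewrite derive_val.
Qed.

End Rotation.

Section RelativeEquilibria.
Context {R : realType} {N : nat} (Gamma : 'I_N -> R).
Local Notation T := 'M[R]_(2, N).
Implicit Types (x y : T) (i j l : 'I_N) (a : 'I_2).
Local Notation partial := (partial (@unit_mx R 2 N)).
Local Notation smooth := (smooth (@unit_mx R 2 N)).
Local Notation U := (~` @collision R N).
Local Notation vortex_gradient := (vortex_gradient Gamma).
Local Notation energy := (energy Gamma).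

(** The only angular velocity compatible with [vortex_gradient_euler] at angular
  impulse 1. *)
Definition angular_velocity : R := - (2 * pi)^-1 * pair_sum Gamma (fun _ _ => 1).
Local Notation w0 := angular_velocity.

Lemma sum_incidence (u : 'I_N -> R) i j : \sum_l u l * incidence i j l = u i - u j.
Proof.
have E p : \sum_l u l * (l == p)%:R = u p.
  rewrite (bigD1 p)//= eqxx mulr1 big1 ?addr0// => l lp.
  by rewrite (negbTE lp) mulr0.
by under eq_bigr do rewrite mulrBr; rewrite sumrB !E.
Qed.

Lemma sum_pair_sum (J : finType) (c : J -> R) (F : J -> 'I_N -> 'I_N -> R) :
  \sum_k c k * pair_sum Gamma (F k) = pair_sum Gamma (fun i j => \sum_k c k * F k i j).
Proof.
rewrite /pair_sum; under eq_bigr do rewrite mulr_sumr.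
rewrite exchange_big/=; apply: eq_bigr => i _.
under eq_bigr do rewrite mulr_sumr.
rewrite exchange_big/=; apply: eq_bigr => j _.
by rewrite mulr_sumr; apply: eq_bigr => k _; rewrite mulrCA.
Qed.

Lemma eq_pair_sum (F G : 'I_N -> 'I_N -> R) :
  (forall i j, (i < j)%N -> F i j = G i j) -> pair_sum Gamma F = pair_sum Gamma G.
Proof. by move=> FG; apply: eq_bigr => i _; apply: eq_bigr => j /FG ->. Qed.

(** Scaling by [s] adds a constant multiple of [ln s] to the energy; this is the
  derivative of that relation at [s = 1]. *)
Lemma vortex_gradient_euler x : U x -> \sum_a \sum_l x a l * vortex_gradient x a l = w0.
Proof.
move=> Ux.
under eq_bigr do under eq_bigr do rewrite mxE mulrCA.
under eq_bigr do rewrite -mulr_sumr sum_pair_sum.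
rewrite -mulr_sumr /w0; congr (_ * _).
transitivity (\sum_a 1 * pair_sum Gamma (fun i j => (x a i - x a j) ^+ 2 / sqdist i j x)).
  apply: eq_bigr => a _; rewrite mul1r; apply: eq_pair_sum => i j ij.
  transitivity ((\sum_l x a l * incidence i j l) * ((x a i - x a j) / sqdist i j x)).
    by rewrite mulr_suml; apply: eq_bigr => l _; ring.
  by rewrite sum_incidence; ring.
rewrite sum_pair_sum; apply: eq_pair_sum => i j ij.
under eq_bigr do rewrite mul1r.
by rewrite -mulr_suml -sqdist_sum divff// gt_eqF// sqdist_gt0.
Qed.

(** The energy is invariant under translations. *)
Lemma vortex_gradient_translation x a : \sum_l vortex_gradient x a l = 0.
Proof.
under eq_bigr do rewrite mxE.
rewrite -mulr_sumr; under eq_bigr do rewrite -[pair_sum _ _]mul1r.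
rewrite sum_pair_sum (_ : pair_sum _ _ = pair_sum Gamma (fun _ _ => 0)).
  by rewrite /pair_sum big1 ?mulr0// => i _; rewrite big1// => j _; rewrite mulr0.
apply: eq_pair_sum => i j _.
transitivity ((\sum_l 1 * incidence i j l) * ((x a i - x a j) / sqdist i j x)).
  by rewrite mulr_suml; apply: eq_bigr => l _; ring.
by rewrite sum_incidence subrr mul0r.
Qed.

Lemma sqdist_rotation i j t x : sqdist i j (rotation t *m x) = sqdist i j x.
Proof. by rewrite /sqdist !col_mulmx -mulmxBr sqnorm_rotation. Qed.

Lemma vortex_gradient_rotation t x : vortex_gradient (rotation t *m x) = rotation t *m vortex_gradient x.
Proof.
apply/matrixP => a l; rewrite [LHS]mxE [RHS]mxE.
under [RHS]eq_bigr do rewrite [vortex_gradient _ _ _]mxE mulrCA.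
rewrite -mulr_sumr sum_pair_sum; congr (_ * _); apply: eq_pair_sum => i j ij.
rewrite sqdist_rotation ![(rotation t *m x) _ _]mxE -sumrB !mulr_suml.
by apply: eq_bigr => b _; ring.
Qed.

Lemma vorticity_mxE x a l : (x *m vorticity_mx Gamma) a l = x a l * Gamma l.
Proof. by rewrite mul_mx_diag !mxE. Qed.

Definition critical : set T :=
  [set x | U x /\ vortex_gradient x = w0 *: (x *m vorticity_mx Gamma)].

Lemma sum_vorticity x : \sum_a \sum_l x a l * (x *m vorticity_mx Gamma) a l = ang_impulse Gamma x.
Proof.
rewrite exchange_big ang_impulseE; apply: eq_bigr => l _; rewrite mulr_sumr.
by apply: eq_bigr => a _; rewrite vorticity_mxE; ring.
Qed.

(** The equation of motion at time 0 gives the gradient up to the unknown angular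
  velocity, which Euler's identity determines. *)
Lemma relative_equilibrium_critical z : relative_equilibrium Gamma z ->
  normalised Gamma z -> critical (z 0).
Proof.
move=> [sz [w zw]] nz; have [m0 I0] := nz 0.
have [Uz _ dz] := sz 0; split=> //.
have zE : z = (fun t => rotation (w * t) *m z 0).
  apply/funext => t; apply/matrixP => a i.
  have /= := zw i t; rewrite /vorticity_center m0 scaler0 subr0 addr0 expmx_J2.
  by move=> /matrixP/(_ a 0); rewrite mxE => ->; rewrite -col_mulmx mxE.
have D := is_derive_rotation w 0 (z 0).
rewrite -zE mulr0 in D.
have E : w *: (z 0 *m vorticity_mx Gamma) = vortex_gradient (z 0).
  apply: oppr_inj; rewrite -!J2_mulmxK -(gradient_energy Gamma Uz) -dz derive1E.
  rewrite derive_val rotation_mulmx cos0 sin0 scale1r scale0r addr0.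
  by rewrite -scalemxAl -!scalemxAr !mulmxA.
have := vortex_gradient_euler Uz; rewrite -E.
under eq_bigr do under eq_bigr do rewrite mxE mulrCA.
under eq_bigr do rewrite -mulr_sumr.
by rewrite -mulr_sumr sum_vorticity I0 mulr1 => ->.
Qed.

Hypothesis hN : (2 <= N)%N.
Hypothesis hGamma : forall i, 0 < Gamma i.

Lemma pair_sum_gt0 : 0 < pair_sum Gamma (fun _ _ => 1).
Proof.
have h0 : (0 < N)%N by exact: leq_trans hN.
rewrite /pair_sum (bigD1 (Ordinal h0))//= (bigD1 (Ordinal hN))//=.
rewrite -addrA; apply: ltr_wpDr; last by rewrite !mulr_gt0.
by rewrite addr_ge0// sumr_ge0// => i _; rewrite ?sumr_ge0// => *; rewrite !mulr_ge0// ltW.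
Qed.

Lemma angular_velocity_neq0 : w0 != 0.
Proof.
apply: mulf_neq0; last by rewrite gt_eqF// pair_sum_gt0.
by rewrite oppr_eq0 invr_eq0 gt_eqF// mulr_gt0// pi_gt0.
Qed.

Lemma critical_ang_impulse x : critical x -> ang_impulse Gamma x = 1.
Proof.
move=> [Ux Ex]; apply: (mulfI angular_velocity_neq0); rewrite mulr1 -sum_vorticity mulr_sumr.
rewrite -[RHS](vortex_gradient_euler Ux) Ex; apply: eq_bigr => a _; rewrite mulr_sumr.
by apply: eq_bigr => l _; rewrite mulrCA [in RHS]mxE.
Qed.

Lemma critical_moment x : critical x -> moment Gamma x = 0.
Proof.
move=> [Ux Ex]; apply/matrixP => a b; rewrite mxE.
apply: (mulfI angular_velocity_neq0); rewrite mulr0 -(vortex_gradient_translation x a) Ex.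
rewrite summxE mulr_sumr; apply: eq_bigr => l _.
by rewrite [RHS]mxE vorticity_mxE 2!mxE; ring.
Qed.

Lemma critical_rotation t x : critical x -> critical (rotation t *m x).
Proof.
move=> [Ux Ex]; split; last by rewrite vortex_gradient_rotation Ex -scalemxAr mulmxA.
apply/noncollisionP => i j ij; rewrite sqdist_rotation.
exact: sqdist_gt0.
Qed.

Lemma energy_rotation t x : energy (rotation t *m x) = energy x.
Proof.
rewrite /Defs.energy; congr (_ * _); apply: eq_bigr => i _; apply: eq_bigr => j _.
by have := sqdist_rotation i j t x; rewrite /sqdist => ->.
Qed.

(** The rotation of a critical configuration solves the equation of motion at all
  times, because the gradient is equivariant. *)
Lemma critical_relative_equilibrium x : critical x ->
  exists z, [/\ relative_equilibrium Gamma z, normalised Gamma z &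
    forall t : R, energy (z t) = energy x].
Proof.
move=> cx; pose z (t : R) := rotation (w0 * t) *m x.
have z0 : z 0 = x by rewrite /z mulr0 rotation_mulmx cos0 sin0 scale1r scale0r addr0.
have cz t : critical (z t) by exact: critical_rotation.
have mz t : moment Gamma (z t) = 0 by exact: critical_moment.
exists z; split.
- split=> [t|].
    have [Dz dzE] := is_derive_rotation w0 t x.
    have [Uz Ez] := cz t; split; [exact: Uz|exact: Dz|].
    rewrite derive1E dzE gradient_energy// Ez -/(z t).
    by rewrite -scalemxAl -scalemxAr -[in LHS]mulmxA.
  exists w0 => i t /=; rewrite /vorticity_center mz scaler0 subr0 addr0 z0.
  by rewrite expmx_J2 -/(rotation _) col_mulmx.
- by move=> t; split; [exact: mz|exact: critical_ang_impulse].
- by move=> t; exact: energy_rotation.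
Qed.

Lemma normalised_re_energiesE : normalised_re_energies Gamma = energy @` critical.
Proof.
apply/seteqP; split=> h.
  by move=> [z [rz nz zh]]; exists (z 0) => //; exact: relative_equilibrium_critical.
by move=> [x /critical_relative_equilibrium[z [rz nz zh]] <-]; exists z.
Qed.

End RelativeEquilibria.

(** * The set of energies *)

Section Energies.
Context {R : realType} {N : nat} (Gamma : 'I_N -> R).
Context (hN : (2 <= N)%N) (hGamma : forall i, 0 < Gamma i).
Local Notation T := 'M[R]_(2, N).
Local Notation I := ('I_2 * 'I_N)%type.
Implicit Types (x y : T) (i j l : 'I_N) (a : 'I_2).
Local Notation partial := (partial (@unit_mx R 2 N)).
Local Notation smooth := (smooth (@unit_mx R 2 N)).
Local Notation U := (~` @collision R N).
Local Notation energy := (energy Gamma).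
Local Notation w0 := (angular_velocity Gamma).
Local Notation oU := (@open_noncollision R N).

(** The Lagrange multiplier of the constraint of impulse 1 is known in advance, so
  constrained critical points are free critical points of this function; the
  constant makes it agree with the energy at impulse 1. *)
Definition augmented_energy : T -> R :=
  energy + (- (w0 / 2)) *: (ang_impulse Gamma + cst (- 1)).
Local Notation F := augmented_energy.

Lemma ang_impulse_fct : ang_impulse Gamma =
  \sum_l Gamma l *: \sum_a ((fun x : T => x a l) * (fun x : T => x a l)).
Proof.
apply/funext => x; rewrite ang_impulseE fct_sumE; apply: eq_bigr => l _.
by rewrite pointwiseE fct_sumE; congr (_ * _); apply: eq_bigr => a _; rewrite expr2.
Qed.

Lemma smooth_entry2 W l : open W ->
  smooth W (\sum_a ((fun x : T => x a l) * (fun x : T => x a l))).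
Proof.
by move=> oW; apply: smooth_sum => // a _; apply: smoothM => //; exact: smooth_entry.
Qed.

Lemma smooth_ang_impulse W : open W -> smooth W (ang_impulse Gamma).
Proof.
move=> oW; rewrite ang_impulse_fct; apply: smooth_sum => // l _.
by apply: smoothZ => //; exact: smooth_entry2.
Qed.

Lemma partial_ang_impulse a l x : partial (a, l) (ang_impulse Gamma) x = 2 * Gamma l * x a l.
Proof.
have oT : open [set: T] := openT; have xT : x \in [set: T] by rewrite inE.
have sf k p : smooth setT (fun y : T => y k p) by exact: smooth_entry.
rewrite ang_impulse_fct (partial_sum oT) => [|p _|//]; last by apply: smoothZ => //; exact: smooth_entry2.
have pdp p : partial (a, l) (Gamma p *: \sum_b ((fun x : T => x b p) * (fun x : T => x b p))) x =
    Gamma p * (2 * x a p * (p == l)%:R).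
  rewrite (partialZ (U := setT))//; last exact: smooth_entry2.
  rewrite pointwiseE (partial_sum oT)//; last by move=> k _; apply: smoothM.
  congr (_ * _); rewrite fct_sumE (bigD1 a)//= big1 ?addr0 => [|k ka].
    by rewrite (partialM (U := setT))// !pointwiseE !partial_entry !xpair_eqE eqxx /=; ring.
  by rewrite (partialM (U := setT))// !pointwiseE !partial_entry !xpair_eqE (negbTE ka) /=; ring.
rewrite fct_sumE (bigD1 l)//= pdp eqxx big1 ?addr0 => [|p pl]; first by rewrite mulr1; ring.
by rewrite pdp (negbTE pl) !mulr0.
Qed.

Lemma smooth_augmented_energy : smooth U F.
Proof.
have h := oU; apply: smoothD => //; first exact: smooth_energy.
apply: smoothZ => //; apply: smoothD => //; last exact: smooth_cst.
exact: smooth_ang_impulse.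
Qed.

Lemma partial_augmented_energy a l x : U x ->
  partial (a, l) F x = vortex_gradient Gamma x a l - w0 * (x a l * Gamma l).
Proof.
move=> Ux; have h := oU; have xU : x \in U by rewrite inE.
have sI := smooth_ang_impulse h.
have sC : smooth U (cst (- 1)) by exact: smooth_cst.
have sIC := smoothD h sI sC.
rewrite (partialD (U := U))//; [|exact: smooth_energy|exact: smoothZ].
rewrite pointwiseE partial_energy// (partialZ (U := U))// pointwiseE (partialD (U := U))// pointwiseE partial_ang_impulse.
by rewrite partial_cst addr0; congr (_ + _); lra.
Qed.

Lemma criticalP x : critical Gamma x <-> U x /\ forall b, partial b F x = 0.
Proof.
split=> [[Ux Ex]|[Ux dF]]; split=> //.
  by move=> [a l]; rewrite partial_augmented_energy// Ex mxE vorticity_mxE subrr.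
apply/matrixP => a l; have := dF (a, l); rewrite partial_augmented_energy// => /eqP.
by rewrite subr_eq0 => /eqP ->; rewrite mxE vorticity_mxE.
Qed.

Lemma negligible_energies :
  (@lebesgue_measure R).-negligible (normalised_re_energies Gamma).
Proof.
rewrite normalised_re_energiesE// (_ : _ @` _ = F @` critical Gamma).
  apply: (sard oU _ smooth_augmented_energy) => [x [] //|b x].
  by rewrite inE => /criticalP[_]; exact.
apply/seteqP; split=> _ [x cx <-]; exists x => //.
all: by rewrite /F !pointwiseE critical_ang_impulse// subrr mulr0 addr0.
Qed.

Lemma closure_value (K : set T) (C : set R) (g : T -> R) x : closure K x ->
  {for x, continuous g} -> closed C -> (forall y, K y -> C (g y)) -> C (g x).
Proof.
move=> Kx cg cC KC; apply: cC => B Bg.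
by have [y [Ky By]] := Kx _ (cg _ Bg); exists (g y); split=> //; exact: KC.
Qed.

Lemma vec_mx_continuous : continuous (@vec_mx R 2 N).
Proof.
move=> v B /nbhs_ballP[eps /= eps0 HB].
apply: filterS (nbhsx_ballx v eps eps0) => w; rewrite -ball_normE /= => vw.
apply: HB; rewrite -ball_normE /=; apply: le_lt_trans vw.
apply: norm_le_entries => // i j; rewrite !mxE.
by have := entry_le_norm (v - w) 0 (mxvec_index i j); rewrite !mxE.
Qed.

(** Transfer of the Heine-Borel theorem from row vectors. *)
Lemma closed_bounded_compact (K : set T) (r : R) : closed K ->
  (forall x, K x -> `|x| <= r) -> compact K.
Proof.
move=> cK Kr.
have -> : K = vec_mx @` (@vec_mx R 2 N @^-1` K).
  apply/seteqP; split=> [x Kx|_ [v Kv <-]//].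
  by exists (mxvec x); rewrite /= mxvecK.
apply: continuous_compact; first by apply: continuous_subspaceT; exact: vec_mx_continuous.
apply: bounded_closed_compact; last first.
  by apply: closed_comp => // v _; exact: vec_mx_continuous.
exists r; split=> [|M rM v /Kr vr]; first exact: num_real.
apply: le_trans (ltW rM); apply: le_trans vr.
apply: norm_le_entries => // i j; rewrite ord1.
case/mxvec_indexP: j => k l.
by have := entry_le_norm (vec_mx v) k l; rewrite mxE.
Qed.

(** A bound, at impulse 1, for the squared distance of each vortex to the origin. *)
Definition radius2 : R := \sum_l (Gamma l)^-1.

Lemma col_bound l x : ang_impulse Gamma x = 1 -> \sum_a x a l ^+ 2 <= radius2.
Proof.
move=> I1; have sq0 p : 0 <= \sum_a x a p ^+ 2 by rewrite sumr_ge0// => a _; exact: sqr_ge0.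
apply: (@le_trans _ _ (Gamma l)^-1).
  rewrite -[leRHS]mul1r ler_pdivlMr// mulrC -I1 ang_impulseE (bigD1 l)//= lerDl.
  by rewrite sumr_ge0// => p _; rewrite mulr_ge0// ltW.
by rewrite /radius2 (bigD1 l)//= lerDl sumr_ge0// => p _; rewrite invr_ge0 ltW.
Qed.

Lemma sqdist_bound i j x : ang_impulse Gamma x = 1 -> sqdist i j x <= 4 * radius2 + 1.
Proof.
move=> I1; have := col_bound i I1; have := col_bound j I1.
rewrite sqdist_sum; have : \sum_k (x k i - x k j) ^+ 2 <= 2 * (\sum_k x k i ^+ 2) + 2 * \sum_k x k j ^+ 2.
  rewrite !mulr_sumr -big_split/=; apply: ler_sum => k _.
  by have := sqr_ge0 (x k i + x k j); nra.
lra.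
Qed.

Definition separation (h : R) i j : R :=
  let d := ln (4 * radius2 + 1) in
  expR (d - (pair_sum Gamma (fun _ _ => d) + 4 * pi * h) / (Gamma i * Gamma j)).

(** At impulse 1 the configuration is bounded, so every term
  [- Gamma i * Gamma j * ln (sqdist i j x)] of the energy is bounded below; an
  upper bound on the sum then bounds each term above. *)
Lemma sqdist_separation h x : U x -> ang_impulse Gamma x = 1 -> energy x <= h ->
  forall i j, (i < j)%N -> separation h i j <= sqdist i j x.
Proof.
move=> Ux I1 Eh i j ij.
have d0 := sqdist_gt0 Ux ij.
rewrite -[leRHS]lnK// ler_expR; set d := ln (4 * _ + _).
have GG0 : 0 < Gamma i * Gamma j by rewrite mulr_gt0.
have term (p q : 'I_N) : (p < q)%N -> 0 <= Gamma p * Gamma q * (d - ln (sqdist p q x)).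
  move=> pq; rewrite mulr_ge0//; first by rewrite mulr_ge0 ?ltW.
  rewrite subr_ge0 ler_ln ?posrE ?sqdist_gt0//; first exact: sqdist_bound.
  by apply: lt_le_trans (sqdist_bound i j I1).
rewrite lerBlDr -lerBlDl ler_pdivlMr// mulrC.
have total : pair_sum Gamma (fun p q => d - ln (sqdist p q x)) <= pair_sum Gamma (fun _ _ => d) + 4 * pi * h.
  rewrite (_ : pair_sum _ _ = pair_sum Gamma (fun _ _ => d) + 4 * pi * energy x).
    by rewrite lerD2l ler_wpM2l// mulr_ge0// pi_ge0.
  rewrite /Defs.energy mulrA mulrN divff ?mulN1r; last first.
    by rewrite mulf_neq0// gt_eqF// pi_gt0.
  rewrite /pair_sum -sumrB; apply: eq_bigr => p _; rewrite -sumrB.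
  by apply: eq_bigr => q _; rewrite mulrBr.
apply: le_trans total; rewrite /pair_sum (bigD1 i)//= (bigD1 j)//=.
rewrite -addrA lerDl addr_ge0// sumr_ge0// => p; first by move=> /andP[ip _]; exact: term.
by move=> _; rewrite sumr_ge0// => q; exact: term.
Qed.

(** Near a limit value [h] only energies below [h + 1] matter, and they all come
  from the compact set [K]. *)
Lemma closed_energies : closed (normalised_re_energies Gamma).
Proof.
rewrite normalised_re_energiesE// => h hcl.
pose K := [set x : T | [/\ ang_impulse Gamma x = 1,
   forall i j, (i < j)%N -> separation (h + 1) i j <= sqdist i j x &
   forall b, partial b F x = 0]].
have KU : K `<=` U.
  move=> x [_ Kx _]; apply/noncollisionP => i j ij.
  by apply: lt_le_trans (Kx i j ij); exact: expR_gt0.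
have Kc : energy @` K `<=` energy @` critical Gamma.
  move=> _ [x Kx <-]; exists x => //; apply/criticalP; split; first exact: KU.
  by have [] := Kx.
have closedK : closed K.
  move=> x clx.
  have sepx i j : (i < j)%N -> separation (h + 1) i j <= sqdist i j x.
    move=> ij; apply: (closure_value clx (@continuous_sqdist R N i j x) (@closed_ge R _)).
    by move=> y [_ + _]; exact.
  have Ux : U x.
    apply/noncollisionP => i j ij.
    by apply: lt_le_trans (sepx i j ij); exact: expR_gt0.
  split=> // [|b].
  - apply: (closure_value clx _ (@closed_eq R 1)) => [|y []//].
    exact: (smooth_continuous (smooth_ang_impulse openT)).
  - apply: (closure_value clx _ (@closed_eq R 0)) => [|y [_ _]]; last exact.
    by apply: (smooth_continuous (smooth_partial b smooth_augmented_energy)).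
have compactK : compact K.
  apply: (@closed_bounded_compact _ (radius2 + 1)) => // x [I1 _ _].
  have r0 : 0 <= radius2 by apply: sumr_ge0 => l _; rewrite invr_ge0 ltW.
  apply: norm_le_entries => [|a l]; first by rewrite addr_ge0.
  have := col_bound l I1; rewrite (bigD1 a)//= => le1.
  have : x a l ^+ 2 <= radius2.
    by apply: le_trans le1; rewrite lerDl sumr_ge0// => k _; exact: sqr_ge0.
  by rewrite -real_normK ?num_real//; move: (normr_ge0 (x a l)); nra.
apply: Kc.
have : closed (energy @` K).
  apply: compact_closed; first exact: Rhausdorff.
  apply: continuous_compact compactK.
  apply: continuous_in_subspaceT => x; rewrite inE => /KU Ux.
  exact: smooth_continuous (smooth_energy Gamma) Ux.
apply=> B Bh.
have Bh' : nbhs h (B `&` [set t | t < h + 1]).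
  by apply: filterI => //; apply: open_nbhs_nbhs; split; [exact: open_lt|rewrite /= ltrDl].
have [_ [[x cx <-] [Bx xh]]] := hcl _ Bh'.
exists (energy x); split=> //; exists x => //.
have [Ux dF] := (criticalP x).1 cx; have I1 := critical_ang_impulse hN hGamma cx.
split=> //; apply: sqdist_separation => //; exact: ltW.
Qed.

End Energies.

Theorem theorem2p1 (R : realType) (N : nat) (Gamma : 'I_N -> R)
    (hN : (2 <= N)%N) (hGamma : forall i : 'I_N, 0 < Gamma i) :
  closed (normalised_re_energies Gamma) /\
  lebesgue_measure (normalised_re_energies Gamma) = 0%E.
Proof.
have cE := closed_energies hN hGamma; split=> //.
apply: measure_negligible; last exact: negligible_energies.
exact: closed_measurable.
Qed.
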